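(* Let $f:\mathrm{Sym}_{++}(n)\to\mathbb R$ be twice continuously differentiable, and let $P^\star\in\mathrm{Sym}_{++}(n)$ be a nondegenerate local minimizer of $f$. Let $H_1(P^\star)$ and $H_{\mathrm{AI}}(P^\star)$ be the matrices of the Riemannian Hessian of $f$ at $P^\star$ with respect to the Alpha-Procrustes metric $g^{(1)}$ and the affine-invariant metric $g^{\mathrm{AI}}$, respectively. If $$\kappa(P^\star)>\sqrt2\,\kappa(H_E(P^\star)),$$ then $\kappa(H_1(P^\star))<\kappa(H_{\mathrm{AI}}(P^\star))$.
   Context: $\mathrm{Sym}(n)$ is the space of real symmetric $n\times n$ matrices with the Frobenius inner product $\langle X,Y\rangle_F=\mathrm{tr}(X^\top Y)$. $\mathrm{Sym}_{++}(n)$ is the manifold of symmetric positive definite matrices, with tangent spaces identified with $\mathrm{Sym}(n)$. Real powers, $\log$ and $\exp$ of matrices are defined by spectral calculus, and $(Df)(A)[E]$ denotes the Fréchet derivative of $f$ at $A$ in direction $E$. Alpha-Procrustes metric: for $P\in\mathrm{Sym}_{++}(n)$, $\alpha\in\mathbb R$ and $Y\in\mathrm{Sym}(n)$, $\mathcal L_{P,\alpha}(Y)$ is the unique $H\in\mathrm{Sym}(n)$ with $$(D\exp)(\log P)\circ(D\log)(P^{2\alpha})[HP^{2\alpha}+P^{2\alpha}H]=Y,$$ and $g^{(\alpha)}_P(X,Y)=4\,\mathrm{tr}\big(\mathcal L_{P,\alpha}(X)\,P^{2\alpha}\,\mathcal L_{P,\alpha}(Y)\big)$ for $X,Y\in\mathrm{Sym}(n)$.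 Affine-invariant metric: $g^{\mathrm{AI}}_P(X,Y)=\mathrm{tr}(P^{-1}XP^{-1}Y)$. Euclidean gradient and Hessian: $\nabla f(P)\in\mathrm{Sym}(n)$ is defined by $\langle\nabla f(P),Y\rangle_F=(Df)(P)[Y]$, and $\nabla^2f(P)[Y]=(D(\nabla f))(P)[Y]$. A local minimizer $P^\star$ is nondegenerate if $\langle Y,\nabla^2 f(P^\star)[Y]\rangle_F>0$ for all nonzero $Y\in\mathrm{Sym}(n)$. For a Riemannian metric $g$ on $\mathrm{Sym}_{++}(n)$, the Riemannian gradient is defined by $g_P(\mathrm{grad}^gf(P),Y)=(Df)(P)[Y]$, and the Riemannian Hessian is $\mathrm{Hess}^gf(P)[Y]=\nabla^g_Y\mathrm{grad}^gf(P)$, with $\nabla^g$ the Levi-Civita connection of $g$. Basis: write $P^\star=Q\Lambda Q^\top$ with $Q$ orthogonal and $\Lambda$ diagonal. $\mathcal B_{P^\star}$ is the Frobenius-orthonormal basis of $\mathrm{Sym}(n)$ consisting of $Qe_ie_i^\top Q^\top$ ($1\le i\le n$) and $\frac1{\sqrt2}Q(e_ie_j^\top+e_je_i^\top)Q^\top$ ($1\le i<j\le n$). $H_E(P^\star)$, $H_1(P^\star)$, $H_{\mathrm{AI}}(P^\star)$ are the matrices in the basis $\mathcal B_{P^\star}$ of $\nabla^2f(P^\star)$ and of the Riemannian Hessians at $P^\star$ for $g^{(1)}$ and $g^{\mathrm{AI}}$, respectively. These matrices, like $P^\star$, have real positive eigenvalues, and $\kappa$ of any of them denotes the ratio of the largest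 to the smallest eigenvalue. *)

(* Defs.v *)
From HB Require Import structures.
From mathcomp Require Import all_boot all_order all_algebra.
From mathcomp Require Import all_classical all_reals all_analysis.

Set Implicit Arguments.
Unset Strict Implicit.
Unset Printing Implicit Defensive.

Import Order.TTheory GRing.Theory Num.Theory.
Import numFieldNormedType.Exports.

Local Open Scope classical_set_scope.
Local Open Scope ring_scope.

Definition symm_mx (R : realType) (n : nat) : {pred 'M[R]_n} :=
  fun M => M^T == M.

Fact symm_mx_submod_closed (R : realType) (n : nat) :
  submod_closed (@symm_mx R n).
Proof.
split=> [|a M N]; first by rewrite unfold_in /symm_mx trmx0.
by rewrite !unfold_in /symm_mx linearP /= => /eqP -> /eqP ->.
Qed.

HB.instance Definition _ (R : realType) (n : nat) :=
  GRing.isSubmodClosed.Build R 'M[R]_n (@symm_mx R n)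
    (@symm_mx_submod_closed R n).

(* Sym(n) as a normed space in its own right, so that the library's Frechet
   derivative 'd F P of F : Sym R n -> W is taken along symmetric directions
   only.  The norm is the entrywise sup norm inherited from 'M[R]_n; the space
   is finite dimensional, so any other norm gives the same derivatives. *)
Record Sym (R : realType) (n : nat) := MkSym {
  symval :> 'M[R]_n;
  symvalP : symval \in @symm_mx R n }.

HB.instance Definition _ (R : realType) (n : nat) :=
  [isSub for @symval R n].
HB.instance Definition _ (R : realType) (n : nat) :=
  [Choice of Sym R n by <:].
HB.instance Definition _ (R : realType) (n : nat) :=
  [SubChoice_isSubZmodule of Sym R n by <:].
HB.instance Definition _ (R : realType) (n : nat) :=
  [SubZmodule_isSubLmodule of Sym R n by <:].

Definition sym_norm (R : realType) (n : nat) (X : Sym R n) : R := `|symval X|.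

Fact sym_normD (R : realType) (n : nat) (X Y : Sym R n) :
  sym_norm (X + Y) <= sym_norm X + sym_norm Y.
Proof. exact: ler_normD. Qed.

Fact sym_norm0_eq0 (R : realType) (n : nat) (X : Sym R n) :
  sym_norm X = 0 -> X = 0.
Proof. by move/normr0_eq0 => X0; apply: val_inj; rewrite /= X0. Qed.

Fact sym_normMn (R : realType) (n : nat) (X : Sym R n) (k : nat) :
  sym_norm (X *+ k) = sym_norm X *+ k.
Proof.
rewrite /sym_norm -normrMn; congr `|_|.
exact: (raddfMn (val : Sym R n -> 'M[R]_n)).
Qed.

Fact sym_normN (R : realType) (n : nat) (X : Sym R n) :
  sym_norm (- X) = sym_norm X.
Proof. by rewrite /sym_norm -[RHS]normrN. Qed.

HB.instance Definition _ (R : realType) (n : nat) :=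
  Num.Zmodule_isNormed.Build R (Sym R n)
    (@sym_normD R n) (@sym_norm0_eq0 R n) (@sym_normMn R n) (@sym_normN R n).
HB.instance Definition _ (R : realType) (n : nat) :=
  PseudoMetric.copy (Sym R n) (pseudoMetric_normed (Sym R n)).
HB.instance Definition _ (R : realType) (n : nat) :=
  isPointed.Build (Sym R n) 0.
HB.instance Definition _ (R : realType) (n : nat) :=
  NormedZmod_PseudoMetric_eq.Build R (Sym R n) erefl.

Fact sym_normZ (R : realType) (n : nat) (a : R) (X : Sym R n) :
  `|a *: X| = `|a| * `|X|.
Proof. exact: (normrZ a (symval X)). Qed.

HB.instance Definition _ (R : realType) (n : nat) :=
  PseudoMetricNormedZmod_Lmodule_isNormedModule.Build R (Sym R n)
    (@sym_normZ R n).

Definition spd (R : realType) (n : nat) : set (Sym R n) :=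
  [set P | forall v : 'cV[R]_n, v != 0 -> 0 < (v^T *m symval P *m v) 0 0].

Definition frob (R : realType) (n : nat) (X Y : Sym R n) : R :=
  \tr ((symval X)^T *m symval Y).

(* F is k times continuously differentiable at the points of D, an open set in
   all uses.  The domain being finite dimensional, P |-> 'd F P is C^k for the
   operator norm iff P |-> 'd F P Y is C^k for every direction Y. *)
Fixpoint contdiff (R : realType) (V W : normedModType R) (k : nat)
    (D : set V) (F : V -> W) : Prop :=
  match k with
  | 0 => forall P, D P -> {for P, continuous F}
  | k'.+1 => (forall P, D P -> differentiable F P) /\
             (forall Y : V, contdiff k' D (fun P => 'd F P Y))
  end.

(* h(A) for a real function h; the value does not depend on the spectral
   decomposition Q diag(d) Q^T of A that is used. *)
Definition spectral_fun (R : realType) (n : nat) (h : R -> R) (A : Sym R n) :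
    Sym R n :=
  xget 0 [set B | exists (Q : 'M[R]_n) (d : 'rV[R]_n),
    [/\ Q^T *m Q = 1%:M,
        symval A = Q *m diag_mx d *m Q^T
      & symval B = Q *m diag_mx (map_mx h d) *m Q^T]].

Definition sexp (R : realType) (n : nat) : Sym R n -> Sym R n :=
  spectral_fun (@expR R).
Definition slog (R : realType) (n : nat) : Sym R n -> Sym R n :=
  spectral_fun (@ln R).
Definition spow (R : realType) (n : nat) (P : Sym R n) (a : R) : Sym R n :=
  spectral_fun (fun x => x `^ a) P.

Fact anticomm_subproof (R : realType) (n : nat) (H A : Sym R n) :
  symval H *m symval A + symval A *m symval H \in @symm_mx R n.
Proof.
rewrite unfold_in /symm_mx linearD /= !trmx_mul.
by rewrite (eqP (symvalP H)) (eqP (symvalP A)) addrC.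
Qed.

Definition anticomm (R : realType) (n : nat) (H A : Sym R n) : Sym R n :=
  MkSym (anticomm_subproof H A).

(* A Riemannian metric on Sym++(n): g P X Y, relevant at P in spd only. *)
Definition metric (R : realType) (n : nat) : Type :=
  Sym R n -> Sym R n -> Sym R n -> R.

Definition procrustes_op (R : realType) (n : nat) (alpha : R)
    (P Y : Sym R n) : Sym R n :=
  xget 0 [set H : Sym R n |
    'd (@sexp R n) (slog P)
      ('d (@slog R n) (spow P (2 * alpha)) (anticomm H (spow P (2 * alpha))))
    = Y].

Definition procrustes_metric (R : realType) (n : nat) (alpha : R) :
    metric R n :=
  fun P X Y => 4 * \tr (symval (procrustes_op alpha P X)
                        *m symval (spow P (2 * alpha))
                        *m symval (procrustes_op alpha P Y)).

Definition ai_metric (R : realType) (n : nat) : metric R n :=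
  fun P X Y => \tr (invmx (symval P) *m symval X
                    *m invmx (symval P) *m symval Y).

Definition rgrad (R : realType) (n : nat) (g : metric R n)
    (f : Sym R n -> R) (P : Sym R n) : Sym R n :=
  xget 0 [set G | forall Y, g P G Y = 'd f P Y].

Definition egrad (R : realType) (n : nat) (f : Sym R n -> R) :
    Sym R n -> Sym R n :=
  rgrad (fun _ => @frob R n) f.

Definition ehess (R : realType) (n : nat) (f : Sym R n -> R)
    (P Y : Sym R n) : Sym R n :=
  'd (egrad f) P Y.

(* [nabla Y X] is the covariant derivative of the vector field X along Y.
   Vector fields on Sym++(n) are C^1 maps into Sym(n) rather than smooth ones,
   because the gradient of a C^2 function is only C^1. *)
Record is_levi_civita (R : realType) (n : nat) (g : metric R n)
    (nabla : (Sym R n -> Sym R n) -> (Sym R n -> Sym R n) ->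
             Sym R n -> Sym R n) : Prop := IsLeviCivita {
  nabla_linear_dir : forall (phi : Sym R n -> R) (Y Y' X : Sym R n -> Sym R n),
    contdiff 1 (@spd R n) phi -> contdiff 1 (@spd R n) Y ->
    contdiff 1 (@spd R n) Y' -> contdiff 1 (@spd R n) X ->
    forall P, spd P ->
      nabla (fun S => phi S *: Y S + Y' S) X P
      = phi P *: nabla Y X P + nabla Y' X P;
  nabla_additive : forall Y X X' : Sym R n -> Sym R n,
    contdiff 1 (@spd R n) Y -> contdiff 1 (@spd R n) X ->
    contdiff 1 (@spd R n) X' ->
    forall P, spd P ->
      nabla Y (fun S => X S + X' S) P = nabla Y X P + nabla Y X' P;
  nabla_leibniz : forall (phi : Sym R n -> R) (Y X : Sym R n -> Sym R n),
    contdiff 1 (@spd R n) phi -> contdiff 1 (@spd R n) Y ->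
    contdiff 1 (@spd R n) X ->
    forall P, spd P ->
      nabla Y (fun S => phi S *: X S) P
      = 'd phi P (Y P) *: X P + phi P *: nabla Y X P;
  nabla_torsion_free : forall X Y : Sym R n -> Sym R n,
    contdiff 1 (@spd R n) X -> contdiff 1 (@spd R n) Y ->
    forall P, spd P ->
      nabla X Y P - nabla Y X P = 'd Y P (X P) - 'd X P (Y P);
  nabla_metric : forall X Y Z : Sym R n -> Sym R n,
    contdiff 1 (@spd R n) X -> contdiff 1 (@spd R n) Y ->
    contdiff 1 (@spd R n) Z ->
    forall P, spd P ->
      'd (fun S => g S (Y S) (Z S)) P (X P)
      = g P (nabla X Y P) (Z P) + g P (Y P) (nabla X Z P) }.

Definition levi_civita (R : realType) (n : nat) (g : metric R n) :
    (Sym R n -> Sym R n) -> (Sym R n -> Sym R n) -> Sym R n -> Sym R n :=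
  xget (fun _ _ _ => 0) [set nabla | is_levi_civita g nabla].

(* The tangent vector Y is extended to a constant field; the value at P only
   depends on Y. *)
Definition rhess (R : realType) (n : nat) (g : metric R n)
    (f : Sym R n -> R) (P Y : Sym R n) : Sym R n :=
  levi_civita g (fun _ => Y) (rgrad g f) P.

Definition local_minimizer (R : realType) (n : nat) (f : Sym R n -> R)
    (P : Sym R n) : Prop :=
  spd P /\ \forall S \near P, spd S -> f P <= f S.

Definition nondegenerate_at (R : realType) (n : nat) (f : Sym R n -> R)
    (P : Sym R n) : Prop :=
  forall Y : Sym R n, Y != 0 -> 0 < frob Y (ehess f P Y).

Definition basis_idx (n : nat) : finType :=
  {ij : 'I_n * 'I_n | (ij.1 <= ij.2)%N}.

Definition basis_mx (R : realType) (n : nat) (Q : 'M[R]_n) (i j : 'I_n) :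
    'M[R]_n :=
  if i == j then Q *m delta_mx i i *m Q^T
  else (Num.sqrt 2)^-1 *: (Q *m (delta_mx i j + delta_mx j i) *m Q^T).

Fact basis_mx_sym (R : realType) (n : nat) (Q : 'M[R]_n) (i j : 'I_n) :
  basis_mx Q i j \in @symm_mx R n.
Proof.
rewrite unfold_in /symm_mx /basis_mx; case: ifP => _; apply/eqP.
  by rewrite !trmx_mul trmxK trmx_delta mulmxA.
rewrite linearZ /= !trmx_mul trmxK linearD /= !trmx_delta mulmxA.
by rewrite addrC.
Qed.

Definition sym_basis (R : realType) (n : nat) (Q : 'M[R]_n)
    (k : basis_idx n) : Sym R n :=
  MkSym (basis_mx_sym Q (val k).1 (val k).2).

(* The basis is Frobenius-orthonormal for orthogonal Q, so coordinates are
   inner products with the basis elements. *)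
Definition mx_in_basis (R : realType) (n : nat) (Q : 'M[R]_n)
    (T : Sym R n -> Sym R n) : 'M[R]_#|basis_idx n| :=
  \matrix_(k, l) frob (sym_basis Q (enum_val k))
                      (T (sym_basis Q (enum_val l))).

(* Largest over smallest eigenvalue: the spectrum is finite, and for the
   matrices considered here it is real, positive and (for n > 0) nonempty. *)
Definition kappa (R : realType) (m : nat) (M : 'M[R]_m) : R :=
  sup [set a | eigenvalue M a] / inf [set a | eigenvalue M a].

(* Main.v *)
Require Import Defs.
From HB Require Import structures.
From mathcomp Require Import all_boot all_order all_algebra.
From mathcomp Require Import all_classical all_reals all_analysis.
From mathcomp Require Import ring lra.
Import Order.TTheory GRing.Theory Num.Theory.
Import numFieldNormedType.Exports.

(** The gradient of f vanishes at the minimizer P, so metric compatibility of the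
    Levi-Civita connection gives g_P(Hess f[Y], Z) = D^2 f(P)[Y, Z] for every
    Riemannian metric g (rhess_critical).  In the orthonormal basis attached to
    an eigenbasis of P, with eigenvalues d_i, both metrics are diagonal: on the
    basis matrix of index (i, j) the affine-invariant one has coefficient
    1 / (d_i d_j) (ai_diag) and the Procrustes one
    (d_i + d_j)^2 / (2 (d_i^2 + d_j^2)) (procrustes_diag).  Hence each Riemannian
    Hessian is diag(w) K (rhess_mx), where K is the Euclidean Hessian, a
    symmetric positive definite matrix, and w the inverse coefficients.

    For the Procrustes metric w lies in [1, 2], so kappa(H_1) <= 2 kappa(K)
    (kappa_scaled_le).  For the affine-invariant metric w contains the d_i^2, so
    kappa(P)^2 <= kappa(H_AI) kappa(K) (kappa_scaled_ge).  The hypothesis, squared,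
    says 2 kappa(K)^2 < kappa(P)^2, and the three inequalities combine.

    Most of the work is in giving these objects their meaning.  The Levi-Civita
    connection exists for every metric with C^1 coefficients by Koszul's formula
    (koszul_connectionP).  Spectral functions are differentiable wherever the
    scalar function is differentiable at the eigenvalues
    (spectral_fun_differentiable), by Hermite interpolation.  Differentiating
    exp(log(B) / 2)^2 = B at B = P^2 then identifies Dexp(log P) o Dlog(P^2) with
    twice the inverse of Z |-> ZP + PZ (dexp_dlog_anticomm), which turns the
    equation defining the Procrustes metric into the Lyapunov equation
    2 (H P^2 + P^2 H) = Y P + P Y (procrustes_opE).  Symmetry of K is the symmetry
    of second derivatives (second_diff_sym). *)

Set Implicit Arguments.
Unset Strict Implicit.
Unset Printing Implicit Defensive.

Local Open Scope classical_set_scope.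
Local Open Scope ring_scope.

(** * Diagonalisation of real symmetric matrices *)

Lemma continuous_sum (R : numFieldType) (T : topologicalType)
    (V : normedModType R) I (r : seq I) (P : pred I) (F : I -> T -> V) x :
  (forall i, P i -> {for x, continuous (F i)}) ->
  {for x, continuous (fun y => \sum_(i <- r | P i) F i y)}.
Proof.
move=> h; apply: (@cvg_big _ _ _ _ _ _ _ (nbhs x)) => //.
exact: add_continuous.
Qed.

Lemma mx_norm_leP (R : realType) m n (A : 'M[R]_(m, n)) (c : R) : 0 <= c ->
  reflect (forall i j, `|A i j| <= c) (`|A| <= c).
Proof.
move=> c0; rewrite [X in X <= _]/Num.norm /= mx_normrE.
apply: (iffP (bigmax_leP _ _ _ _)) => [[_ Ac] i j|Ac].
  exact: (Ac (i, j)).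
by split => // -[i j] _; exact: Ac.
Qed.

Lemma entry_le_norm (R : realType) m n (A : 'M[R]_(m, n)) i j :
  `|A i j| <= `|A|.
Proof. by move: i j; apply/mx_norm_leP. Qed.

Section SpectralTheorem.
Variable R : realType.
Implicit Types n k : nat.

Definition dot n (x y : 'rV[R]_n) : R := (x *m y^T) 0 0.

Lemma dotE n (x y : 'rV[R]_n) : dot x y = \sum_i x 0 i * y 0 i.
Proof. by rewrite /dot mxE; apply: eq_bigr => i _; rewrite mxE. Qed.

Lemma dotC n (x y : 'rV[R]_n) : dot x y = dot y x.
Proof. by rewrite !dotE; apply: eq_bigr => i _; rewrite mulrC. Qed.

Lemma dotDl n (x y z : 'rV[R]_n) : dot (x + y) z = dot x z + dot y z.
Proof. by rewrite /dot mulmxDl mxE. Qed.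

Lemma dotZl n a (x z : 'rV[R]_n) : dot (a *: x) z = a * dot x z.
Proof. by rewrite /dot -scalemxAl mxE. Qed.

Lemma dotDr n (x y z : 'rV[R]_n) : dot z (x + y) = dot z x + dot z y.
Proof. by rewrite !(dotC z) dotDl. Qed.

Lemma dotZr n a (x z : 'rV[R]_n) : dot z (a *: x) = a * dot z x.
Proof. by rewrite !(dotC z) dotZl. Qed.

Lemma dotMl n m (x : 'rV[R]_m) (A : 'M[R]_(m, n)) (y : 'rV[R]_n) :
  dot (x *m A) y = dot x (y *m A^T).
Proof. by rewrite /dot trmx_mul trmxK mulmxA. Qed.

Lemma dot_ge0 n (x : 'rV[R]_n) : 0 <= dot x x.
Proof. by rewrite dotE; apply: sumr_ge0 => i _; rewrite -expr2 sqr_ge0. Qed.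

Lemma dot_eq0 n (x : 'rV[R]_n) : (dot x x == 0) = (x == 0).
Proof.
apply/eqP/eqP => [x0|->]; last by rewrite /dot mul0mx mxE.
apply/rowP => i; rewrite mxE.
move: x0; rewrite dotE => /eqP; rewrite psumr_eq0; last first.
  by move=> j _; rewrite -expr2 sqr_ge0.
by move=> /allP /(_ i (mem_index_enum _)) /=; rewrite mulf_eq0 orbb => /eqP.
Qed.

Lemma dot_gt0 n (x : 'rV[R]_n) : x != 0 -> 0 < dot x x.
Proof. by move=> x0; rewrite lt0r dot_ge0 dot_eq0 x0. Qed.

Lemma normed_dot n (x : 'rV[R]_n) : x != 0 ->
  exists2 a, a != 0 & dot (a *: x) (a *: x) = 1.
Proof.
move=> /dot_gt0 x0; exists (Num.sqrt (dot x x))^-1.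
  by rewrite invr_eq0 sqrtr_eq0 -ltNge.
rewrite dotZl dotZr mulrA -invfM -expr2 sqr_sqrtr ?ltW// mulVf//.
by rewrite gt_eqF.
Qed.

Lemma continuous_quad n (A : 'M[R]_n) :
  continuous (fun x : 'rV[R]_n => dot (x *m A) x).
Proof.
have -> : (fun x : 'rV[R]_n => dot (x *m A) x) =
   (fun x => \sum_i \sum_j x 0 j * A j i * x 0 i).
  by apply/funext => x; rewrite dotE; apply: eq_bigr => i _; rewrite mxE mulr_suml.
move=> x; apply: continuous_sum => i _; apply: continuous_sum => j _.
have c l : {for x, continuous (fun y : 'rV[R]_n => y 0 l)}.
  exact: coord_continuous.
exact: (cvgM (cvgM (c j) (@cvg_cst _ (A j i) _ (nbhs x) _)) (c i)).
Qed.

(** Rayleigh's principle: a maximiser of the quadratic form over the unit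
    vectors orthogonal to the eigenvectors already found is a further
    eigenvector, because the form l |y|^2 - y A y^T is nonnegative on that
    orthogonal complement and vanishes at the maximiser. *)
Lemma next_eigenvector n k (A : 'M[R]_n) (V : 'M[R]_(k, n)) (a : 'rV[R]_k) :
  A^T = A -> (k < n)%N -> V *m A = diag_mx a *m V ->
  exists (x : 'rV[R]_n) (l : R), [/\ dot x x = 1, x *m V^T = 0 & x *m A = l *: x].
Proof.
move=> symA kn VA.
pose K := [set x : 'rV[R]_n | dot x x = 1 /\ x *m V^T = 0].
have K0 : K !=set0.
  have : kermx V^T != 0.
    rewrite -mxrank_eq0 mxrank_ker -lt0n subn_gt0.
    by apply: leq_ltn_trans kn; rewrite rank_leq_col.
  move=> /rowV0Pn [u uker u0]; have [c c0 c1] := normed_dot u0.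
  exists (c *: u); split => //; rewrite -scalemxAl.
  by rewrite (sub_kermxP uker) scaler0.
have cK : compact K.
  apply: bounded_closed_compact.
    exists 1; split; first exact: num_real.
    move=> M M1 x [x1 _]; apply: le_trans (ltW M1).
    apply/mx_norm_leP => //= i j; rewrite ord1.
    rewrite -[leRHS]sqrtr1 -x1 -sqrtr_sqr ler_wsqrtr // dotE (bigD1 j) //=.
    by rewrite -expr2 lerDl sumr_ge0 // => ? _; rewrite -expr2 sqr_ge0.
  have -> : K = [set x | dot (x *m 1%:M) x = 1] `&`
                [set x | dot (x *m (V^T *m V)) x = 0].
    apply/seteqP; split => x [/= x1 x2]; split => //=.
    - by rewrite mulmx1.
    - by rewrite mulmxA x2 mul0mx /dot mul0mx mxE.
    - by move: x1; rewrite mulmx1.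
    - by apply/eqP; rewrite -dot_eq0; apply/eqP; move: x2; rewrite mulmxA dotMl.
  apply: closedI.
    apply: (preimage_closed (f := fun x : 'rV[R]_n => dot (x *m 1%:M) x) _
      (closed_eq (y := 1))).
    by move=> x _; exact: continuous_quad.
  apply: (preimage_closed (f := fun x : 'rV[R]_n => dot (x *m (V^T *m V)) x) _
    (closed_eq (y := 0))).
  by move=> x _; exact: continuous_quad.
have [x xK xmax] := compact_EVT_max K0 cK
  (continuous_subspaceT (@continuous_quad n A)).
move: xK; rewrite inE => -[x1 xV]; pose l := dot (x *m A) x.
have Kle y : y *m V^T = 0 -> dot (y *m A) y <= l * dot y y.
  have [->|y0] := eqVneq y 0 => yV; first by rewrite /dot !mul0mx mxE mulr0.
  have [c c0 cy1] := normed_dot y0.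
  have cyK : c *: y \in K by rewrite inE; split => //; rewrite -scalemxAl yV scaler0.
  move: (xmax _ cyK); rewrite -scalemxAl !dotZl !dotZr !mulrA -/l -expr2.
  move: cy1; rewrite !dotZl !dotZr mulrA -expr2 => cy1.
  have c2 : 0 < c ^+ 2 by rewrite exprn_even_gt0.
  by move=> ?; rewrite -(ler_pM2l c2) (mulrCA _ l) cy1 mulr1.
have [z zE] : exists z, z = l *: x - x *m A by exists (l *: x - x *m A).
have zV : z *m V^T = 0.
  rewrite zE mulmxBl -scalemxAl xV scaler0 sub0r -mulmxA.
  have -> : A *m V^T = V^T *m diag_mx a.
    by rewrite -{1}symA -trmx_mul VA trmx_mul tr_diag_mx.
  by rewrite mulmxA xV mul0mx oppr0.
exists x, l; split => //; apply/esym/eqP; rewrite -subr_eq0 -zE -dot_eq0.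
have dAC (u v : 'rV[R]_n) : dot (u *m A) v = dot (v *m A) u.
  by rewrite dotMl symA dotC.
set s := dot z z.
have s0 : 0 <= s by exact: dot_ge0.
have xAz : dot (x *m A) z = l * dot x z - s.
  by rewrite /s {3}zE -(scaleN1r (x *m A)) dotDl !dotZl mulN1r subKr.
(* q(x + t z) >= 0 for all t, with vanishing value at t = 0 and slope 2 s *)
have q0 t : 0 <= t * (s *+ 2) + t ^+ 2 * (l * s - dot (z *m A) z).
  have /Kle : (x + t *: z) *m V^T = 0.
    by rewrite mulmxDl xV -scalemxAl zV scaler0 addr0.
  rewrite mulmxDl -!scalemxAl !dotDl !dotDr !dotZl !dotZr x1 -/l -/s.
  rewrite (dAC z x) (dotC z x) xAz -subr_ge0; set q := (X in 0 <= X) => q0.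
  rewrite (_ : _ + _ = q) // /q; ring.
(* A step against the slope, short enough for the quadratic term of
   coefficient w to be dominated, would make the form negative. *)
set w := l * s - _ in q0.
rewrite eq_le s0 andbT leNgt; apply/negP => s1.
have w0 : 0 < `|w| + 1 by rewrite ltr_wpDl.
have := q0 (- s / (`|w| + 1)); apply/negP; rewrite -ltNge.
have -> : - s / (`|w| + 1) * (s *+ 2) + (- s / (`|w| + 1)) ^+ 2 * w =
  s ^+ 2 / (`|w| + 1) * (w / (`|w| + 1) - 2) by field; rewrite gt_eqF.
rewrite pmulr_rlt0 ?divr_gt0 ?exprn_gt0// subr_lt0 ltr_pdivrMr//.
by have := ler_norm w; have := normr_ge0 w; lra.
Qed.

(** An orthonormal family of eigenvectors of a symmetric matrix is extended one
    vector at a time until it is a basis. *)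
Lemma symm_spectral n (A : 'M[R]_n) : A^T = A ->
  exists (Q : 'M[R]_n) (d : 'rV[R]_n),
    Q^T *m Q = 1%:M /\ A = Q *m diag_mx d *m Q^T.
Proof.
move=> symA.
have [V [a [VV VA]]] : exists (V : 'M[R]_n) (a : 'rV[R]_n),
    V *m V^T = 1%:M /\ V *m A = diag_mx a *m V.
  suff : forall k, (k <= n)%N -> exists (V : 'M[R]_(k, n)) (a : 'rV[R]_k),
      V *m V^T = 1%:M /\ V *m A = diag_mx a *m V by move/(_ n (leqnn n)).
  elim=> [_|k IH kn].
    by exists 0, 0; split; apply/matrixP => -[].
  have [V [a [VV VA]]] := IH (ltnW kn).
  have [x [l [x1 xV xA]]] := next_eigenvector symA kn VA.
  have Vx : V *m x^T = 0 by rewrite -[LHS]trmxK trmx_mul trmxK xV trmx0.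
  have VV1 : col_mx x V *m (col_mx x V)^T = 1%:M.
    rewrite tr_col_mx mul_col_row VV Vx xV.
    have -> : x *m x^T = 1%:M by rewrite [LHS]mx11_scalar -/(dot x x) x1.
    by rewrite -scalar_mx_block.
  have VA1 : col_mx x V *m A = diag_mx (row_mx l%:M a) *m col_mx x V.
    rewrite mul_col_mx xA VA diag_mx_row mul_block_col !mul0mx addr0 add0r.
    congr col_mx; rewrite -mul_scalar_mx; congr (_ *m _).
    by apply/matrixP => i j; rewrite !mxE !ord1.
  by exists (col_mx x V), (row_mx l%:M a).
exists V^T, a; rewrite trmxK; split => //.
by rewrite -mulmxA -VA mulmxA (mulmx1C VV) mul1mx.
Qed.

End SpectralTheorem.

(** * Condition numbers of diagonally rescaled matrices *)

Section ConditionNumbers.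
Variable R : realType.

Lemma sup_max (E : set R) a : E a -> (forall x, E x -> x <= a) -> sup E = a.
Proof.
move=> Ea aub; apply/eqP; rewrite eq_le; apply/andP; split.
  by apply: ge_sup; [exists a | exact: aub].
by apply: ub_le_sup => //; exists a; exact: aub.
Qed.

Lemma inf_min (E : set R) a : E a -> (forall x, E x -> a <= x) -> inf E = a.
Proof.
move=> Ea alb; apply/eqP; rewrite eq_le; apply/andP; split.
  by apply: ge_inf => //; exists a; exact: alb.
by apply: lb_le_inf; [exists a | exact: alb].
Qed.

Lemma eigenvalue_diag n (Q : 'M[R]_n) (d : 'rV[R]_n) c :
  Q^T *m Q = 1%:M -> eigenvalue (Q *m diag_mx d *m Q^T) c ->
  exists i, c = d 0 i.
Proof.
move=> QQ /eigenvalueP [v vP v0].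
have vQ0 : v *m Q != 0.
  apply: contra_neq v0 => vQ0.
  by rewrite -[v]mulmx1 -(mulmx1C QQ) mulmxA vQ0 mul0mx.
have vQd : v *m Q *m diag_mx d = c *: (v *m Q).
  by rewrite scalemxAl -vP -!mulmxA QQ mulmx1.
have [i vi] : exists i, (v *m Q) 0 i != 0.
  apply/existsP; apply: contraNT vQ0; rewrite negb_exists => /forallP h.
  by apply/eqP/rowP => i; rewrite [RHS]mxE; apply/eqP; move: (h i); rewrite negbK.
exists i; move/rowP: vQd => /(_ i); rewrite mul_mx_diag [LHS]mxE [RHS]mxE.
by rewrite mulrC => /(mulIf vi).
Qed.

Lemma symm_rayleigh m (S : 'M[R]_m) : (0 < m)%N -> S^T = S ->
  exists2 a, eigenvalue S a & forall x : 'rV[R]_m, dot (x *m S) x <= a * dot x x.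
Proof.
move=> m0 /symm_spectral [Q [d [QQ ->]]].
pose i := [arg max_(i > Ordinal m0) d 0 i]%O.
have imax j : d 0 j <= d 0 i by rewrite /i; case: arg_maxP => // k _; apply.
have QQ' := mulmx1C QQ.
exists (d 0 i).
  apply/eigenvalueP; exists (delta_mx 0 i *m Q^T); last first.
    apply: contra_neq (oner_neq0 R) => /(congr1 (mulmx^~ Q)).
    rewrite mul0mx -mulmxA QQ mulmx1 => /rowP /(_ i).
    by rewrite !mxE !eqxx.
  rewrite !mulmxA -[_ *m Q^T *m Q]mulmxA QQ mulmx1 scalemxAl; congr (_ *m _).
  apply/rowP => j; rewrite mul_mx_diag !mxE eqxx /=.
  by case: eqP => [->|]; rewrite ?mul1r ?mulr1 ?mul0r ?mulr0.
move=> x; have -> : dot x x = dot (x *m Q) (x *m Q).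
  by rewrite dotMl -mulmxA QQ' mulmx1.
rewrite !mulmxA dotMl trmxK !dotE mulr_sumr; apply: ler_sum => j _.
by rewrite mul_mx_diag mxE mulrAC mulrC -!expr2 ler_wpM2r // sqr_ge0.
Qed.

Definition scaled_sqnorm m (w u : 'rV[R]_m) : R := \sum_i u 0 i ^+ 2 / w 0 i.

(** Conjugating by the square root of the positive diagonal matrix turns
    diag(w) K into a symmetric matrix, so that its extreme eigenvalues are the
    extreme values of the quotient u K u^T / sum_i (u_i^2 / w_i). *)
Lemma scaled_max_eigenvalue m (K : 'M[R]_m) (w : 'rV[R]_m) :
  (0 < m)%N -> K^T = K -> (forall i, 0 < w 0 i) ->
  exists a, [/\ eigenvalue (diag_mx w *m K) a,
    forall u, dot (u *m K) u <= a * scaled_sqnorm w u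
  & forall c, eigenvalue (diag_mx w *m K) c ->
      exists2 u, 0 < scaled_sqnorm w u & dot (u *m K) u = c * scaled_sqnorm w u].
Proof.
move=> m0 symK w0.
pose s := \row_i Num.sqrt (w 0 i); pose t := \row_i (Num.sqrt (w 0 i))^-1.
have s0 i : 0 < Num.sqrt (w 0 i) by rewrite sqrtr_gt0.
have st : diag_mx s *m diag_mx t = 1%:M.
  rewrite mulmx_diag -diag_const_mx; congr diag_mx; apply/rowP => i.
  by rewrite !mxE divff ?gt_eqF.
have ts : diag_mx t *m diag_mx s = 1%:M by exact: mulmx1C.
have ss : diag_mx w = diag_mx s *m diag_mx s.
  rewrite mulmx_diag; congr diag_mx; apply/rowP => i.
  by rewrite !mxE -expr2 sqr_sqrtr ?ltW.
have nt u : scaled_sqnorm w u = dot (u *m diag_mx t) (u *m diag_mx t).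
  rewrite dotE; apply: eq_bigr => i _; rewrite mul_mx_diag !mxE.
  by rewrite -expr2 exprMn exprVn sqr_sqrtr ?ltW.
have nt0 u : u != 0 -> 0 < scaled_sqnorm w u.
  move=> u0; rewrite nt dot_gt0 //; apply: contra_neq u0 => ut.
  by rewrite -[u]mulmx1 -ts mulmxA ut mul0mx.
pose S := diag_mx s *m K *m diag_mx s.
have symS : S^T = S by rewrite /S !trmx_mul tr_diag_mx symK mulmxA.
have dS u : dot (u *m K) u = dot (u *m diag_mx t *m S) (u *m diag_mx t).
  have -> : u *m diag_mx t *m S = u *m K *m diag_mx s.
    by rewrite /S !mulmxA -[u *m _ *m diag_mx s]mulmxA ts mulmx1.
  by rewrite [RHS]dotMl tr_diag_mx -[u *m _ *m _]mulmxA ts mulmx1.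
have [a aS amax] := symm_rayleigh m0 symS.
exists a; split.
- move/eigenvalueP: aS => [x xS x0]; apply/eigenvalueP.
  exists (x *m diag_mx t).
    rewrite ss !mulmxA -[x *m _ *m diag_mx s]mulmxA ts mulmx1.
    rewrite scalemxAl -xS /S !mulmxA -[RHS]mulmxA st mulmx1 //.
  apply: contra_neq x0 => xt.
  by rewrite -[x]mulmx1 -ts mulmxA xt mul0mx.
- by move=> u; rewrite dS nt; exact: amax.
- move=> c /eigenvalueP [v vc v0]; exists (v *m diag_mx w).
    apply: nt0; apply: contra_neq v0 => vw.
    rewrite -[v]mulmx1 -st -[diag_mx s]mulmx1 -st !mulmxA.
    by rewrite -[v *m _ *m _]mulmxA -ss vw !mul0mx.
  rewrite -mulmxA vc dotZl; congr (_ * _); rewrite dotE.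
  apply: eq_bigr => i _; rewrite mul_mx_diag !mxE expr2.
  by have := w0 i; move=> wi; field; rewrite gt_eqF.
Qed.

(** The smallest eigenvalue is minus the largest eigenvalue of diag(w) (- K). *)
Lemma scaled_extreme_eigenvalues m (K : 'M[R]_m) (w : 'rV[R]_m) :
  (0 < m)%N -> K^T = K -> (forall i, 0 < w 0 i) ->
  let E := [set c | eigenvalue (diag_mx w *m K) c] in
  [/\ E (sup E), E (inf E),
    forall u, inf E * scaled_sqnorm w u <= dot (u *m K) u <= sup E * scaled_sqnorm w u
  & forall c, E c ->
      exists2 u, 0 < scaled_sqnorm w u & dot (u *m K) u = c * scaled_sqnorm w u].
Proof.
move=> m0 symK w0 E.
have [a [aE amax Equot]] := scaled_max_eigenvalue m0 symK w0.
have symNK : (- K)^T = - K by rewrite linearN /= symK.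
have [b [bE bmax _]] := scaled_max_eigenvalue m0 symNK w0.
have dN (u : 'rV[R]_m) : dot (u *m - K) u = - dot (u *m K) u.
  by rewrite mulmxN -scaleN1r dotZl mulN1r.
have supE : sup E = a.
  apply: sup_max => // c /Equot [u u0 uc]; have := amax u.
  by rewrite uc ler_pM2r.
have infE : inf E = - b.
  apply: inf_min => [|c /Equot [u u0 uc]].
    move/eigenvalueP: bE => [v vb v0]; apply/eigenvalueP; exists v => //.
    by rewrite scaleNr -vb mulmxN mulmxN opprK.
  have := bmax u; rewrite dN uc => h.
  by rewrite -(ler_pM2r u0) mulNr lerNl.
rewrite supE infE; split; [by [] | | | exact: Equot].
- move/eigenvalueP: bE => [v vb v0]; apply/eigenvalueP; exists v => //.
  by rewrite scaleNr -vb mulmxN mulmxN opprK.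
- by move=> u; rewrite amax andbT mulNr lerNl -dN.
Qed.

Section PositiveDefinite.
Variables (m : nat) (K : 'M[R]_m).
Hypotheses (m0 : (0 < m)%N) (symK : K^T = K).
Hypothesis posK : forall u : 'rV[R]_m, u != 0 -> 0 < dot (u *m K) u.

Lemma scaled_eigenvalue_gt0 (w : 'rV[R]_m) c : (forall i, 0 < w 0 i) ->
  eigenvalue (diag_mx w *m K) c -> 0 < c.
Proof.
move=> w0 /(let: And4 _ _ _ h := scaled_extreme_eigenvalues m0 symK w0 in h c).
move=> [u u0 uc]; rewrite -(pmulr_lgt0 _ u0) -uc; apply: posK.
apply: contraTneq u0 => ->; rewrite /scaled_sqnorm big1 ?ltxx // => i _.
by rewrite mxE expr0n mul0r.
Qed.

Let one : 'rV[R]_m := const_mx 1.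

Let one0 i : 0 < one 0 i. Proof. by rewrite mxE. Qed.

Let diag_oneK : K = diag_mx one *m K.
Proof. by rewrite /one diag_const_mx mul1mx. Qed.

(** Rescaling by weights in [lo, hi] changes the quotient whose extreme values
    are the eigenvalues by a factor between lo and hi. *)
Lemma kappa_scaled_le (w : 'rV[R]_m) lo hi : 0 < lo ->
  (forall i, lo <= w 0 i <= hi) ->
  kappa (diag_mx w *m K) <= hi / lo * kappa K.
Proof.
move=> lo0 wb; have w0 i : 0 < w 0 i.
  by have /andP[? _] := wb i; exact: lt_le_trans lo0 _.
rewrite {2}diag_oneK /kappa.
have [supE infE bnd quot] := scaled_extreme_eigenvalues m0 symK w0.
have [supE1 infE1 bnd1 _] := scaled_extreme_eigenvalues m0 symK one0.
have a0 := scaled_eigenvalue_gt0 w0 supE; have b0 := scaled_eigenvalue_gt0 w0 infE.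
have a1 := scaled_eigenvalue_gt0 one0 supE1; have b1 := scaled_eigenvalue_gt0 one0 infE1.
have sq u : lo * scaled_sqnorm w u <= scaled_sqnorm one u <= hi * scaled_sqnorm w u.
  rewrite !mulr_sumr; apply/andP; split; apply: ler_sum => i _;
    rewrite [one _ _]mxE divr1 mulrCA; have /andP[h1 h2] := wb i.
    by rewrite ler_piMr ?sqr_ge0 // ler_pdivrMr // mul1r.
  by rewrite ler_peMr ?sqr_ge0 // ler_pdivlMr // mul1r.
have hsup : sup [set a | eigenvalue (diag_mx w *m K) a] <=
            hi * sup [set a | eigenvalue (diag_mx one *m K) a].
  have [u u0 uc] := quot _ supE.
  rewrite -(ler_pM2r u0) -uc; have /andP[_ h] := bnd1 u; apply: (le_trans h).
  rewrite (mulrC hi) -mulrA ler_pM2l //.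
  by have /andP[] := sq u.
have hinf : lo * inf [set a | eigenvalue (diag_mx one *m K) a] <=
            inf [set a | eigenvalue (diag_mx w *m K) a].
  have [u u0 uc] := quot _ infE.
  rewrite -(ler_pM2r u0) -uc; have /andP[h _] := bnd1 u; apply: le_trans h.
  rewrite (mulrC lo) -mulrA ler_pM2l //.
  by have /andP[] := sq u.
move: (sup _) (inf _) (sup _) (inf _) a0 b0 a1 b1 hsup hinf => a' b' a b.
move=> a0 b0 a1 b1 hsup hinf.
rewrite mulf_div; apply: ler_pM => //; first exact: ltW.
  by rewrite invr_ge0; exact: ltW.
by rewrite lef_pV2 // posrE mulr_gt0.
Qed.

(** On the coordinate vectors e_i and e_j the quotient takes the values
    w_i K_ii and w_j K_jj, and the diagonal entries of K lie between its extreme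
    eigenvalues. *)
Lemma kappa_scaled_ge (w : 'rV[R]_m) i j : (forall i, 0 < w 0 i) ->
  w 0 i / w 0 j <= kappa (diag_mx w *m K) * kappa K.
Proof.
move=> w0; rewrite {2}diag_oneK /kappa.
have [supE infE bnd _] := scaled_extreme_eigenvalues m0 symK w0.
have [supE1 infE1 bnd1 _] := scaled_extreme_eigenvalues m0 symK one0.
have a0 := scaled_eigenvalue_gt0 w0 supE; have b0 := scaled_eigenvalue_gt0 w0 infE.
have a1 := scaled_eigenvalue_gt0 one0 supE1; have b1 := scaled_eigenvalue_gt0 one0 infE1.
have sqe (v : 'rV[R]_m) k : scaled_sqnorm v (delta_mx 0 k) = (v 0 k)^-1.
  rewrite /scaled_sqnorm (bigD1 k) //= !mxE !eqxx expr1n mul1r big1 ?addr0 //.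
  by move=> l lk; rewrite !mxE (negbTE lk) andbF expr0n mul0r.
have one1 k : (one 0 k)^-1 = 1 by rewrite mxE invr1.
move: (sup _) (inf _) (sup _) (inf _) a0 b0 a1 b1 bnd bnd1 {supE infE supE1 infE1}
  => a' b' a b a0 b0 a1 b1 bnd bnd1.
have h1 : b' * w 0 i <= a.
  have /andP[h _] := bnd1 (delta_mx 0 i); have /andP[_ g] := bnd (delta_mx 0 i).
  have := le_trans h g; rewrite !sqe one1 mulr1.
  by rewrite ler_pdivlMr.
have h2 : b <= a' * w 0 j.
  have /andP[h _] := bnd (delta_mx 0 j); have /andP[_ g] := bnd1 (delta_mx 0 j).
  have := le_trans h g; rewrite !sqe one1 mulr1.
  by rewrite ler_pdivrMr.
rewrite mulf_div ler_pdivrMr // mulrAC ler_pdivlMr ?mulr_gt0 //.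
have -> : w 0 i * (b * b') = (b' * w 0 i) * b by ring.
have -> : a * a' * w 0 j = a * (a' * w 0 j) by ring.
apply: ler_pM => //; last exact: ltW.
by apply: mulr_ge0; exact: ltW.
Qed.

Lemma kappa_gt0 : 0 < kappa K.
Proof.
rewrite /kappa {1 2}diag_oneK.
have [supE infE _ _] := scaled_extreme_eigenvalues m0 symK one0.
by rewrite divr_gt0 //; apply: (scaled_eigenvalue_gt0 one0).
Qed.

Lemma kappa_quotient : exists a b,
  [/\ eigenvalue K a, eigenvalue K b & kappa K = a / b].
Proof.
have [supE infE _ _] := scaled_extreme_eigenvalues m0 symK one0.
exists (sup [set c | eigenvalue K c]), (inf [set c | eigenvalue K c]).
by rewrite diag_oneK.
Qed.

End PositiveDefinite.

Lemma kappa_mx0 (m : nat) (M : 'M[R]_m) : m = 0%N -> kappa M = 0.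
Proof.
move=> m0; rewrite /kappa (_ : [set a | _] = set0) ?sup0 ?mul0r //.
apply/seteqP; split => // a /= /eigenvalueP [v _ /eqP []].
by subst m; apply/rowP => -[].
Qed.

End ConditionNumbers.

(** * Differential calculus on an open set *)

Section Calculus.
Variables (R : realType) (V : normedModType R).

Lemma diff_eps (W : normedModType R) (f : V -> W) x : differentiable f x ->
  forall e, 0 < e ->
    \forall y \near x, `|f y - f x - 'd f x (y - x)| <= e * `|y - x|.
Proof.
move=> [[_ fx]] e e0; have := (eqaddoP _ _ _ _).1 fx e e0.
by apply: filterS => y /=; rewrite !fctE lim_id // opprD addrA.
Qed.

Lemma is_diff_of_eps (W : normedModType R) (f : V -> W)
    (df : {linear V -> W}) x : continuous df ->
  (forall e, 0 < e ->
    \forall y \near x, `|f y - f x - df (y - x)| <= e * `|y - x|) ->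
  is_diff x f df.
Proof.
move=> dfc h.
have hs : f \o shift x = cst (f x) + df +o_ 0 id.
  apply/eqaddoP => e e0; rewrite /= [\forall x \near _, _ <= _](near_shift x).
  apply: filterS (h e e0) => y /=.
  by rewrite !fctE /= sub0r addrNK opprD addrA.
apply: DiffDef; last exact: diff_unique.
by apply/diff_locallyP; rewrite (diff_unique dfc hs).
Qed.

(** The derivative at a point depends on the germ of the function only. *)
Lemma near_eq_is_diff (W : normedModType R) (f g : V -> W) x :
  (\forall y \near x, f y = g y) -> differentiable f x -> is_diff x g ('d f x).
Proof.
move=> fg dfx; apply: is_diff_of_eps; first exact: diff_continuous.
move=> e e0; have fgx : f x = g x by exact: nbhs_singleton fg.
apply: filterS2 (diff_eps dfx e0) fg => y.
by rewrite fgx => + <-.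
Qed.

Lemma near_eq_continuous (W : topologicalType) (f g : V -> W) x :
  (\forall y \near x, f y = g y) -> {for x, continuous f} ->
  {for x, continuous g}.
Proof.
move=> fg; have fgx : f x = g x by exact: nbhs_singleton fg.
move=> fc; have : f y @[y --> x] --> g x by rewrite -fgx.
by apply: cvg_trans; exact: near_eq_cvg.
Qed.

Lemma is_diff_ex (W : normedModType R) (f df : V -> W) x :
  is_diff x f df -> differentiable f x.
Proof. by case. Qed.

Lemma is_diff_val (W : normedModType R) (f df : V -> W) x u :
  is_diff x f df -> 'd f x u = df u.
Proof. by case=> _ ->. Qed.

Lemma is_diff_scalar (k dk : V -> R) (W : normedModType R) (w : W) x :
  is_diff x k dk -> is_diff x (fun y => k y *: w) (fun y => dk y *: w).
Proof.
move=> [k1 k2]; apply: DiffDef; first exact: differentiableZl.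
by rewrite diffZl // k2.
Qed.

Lemma is_diff_bigsum (W : normedModType R) I (r : seq I) (P : pred I)
    (F dF : I -> V -> W) x :
  (forall i, P i -> is_diff x (F i) (dF i)) ->
  is_diff x (fun y => \sum_(i <- r | P i) F i y)
            (fun y => \sum_(i <- r | P i) dF i y).
Proof.
move=> h; elim: r => [|i r IH].
  have -> : (fun y => \sum_(i <- [::] | P i) F i y) = cst 0.
    by apply/funext => y; rewrite big_nil.
  apply: is_diff_eq; apply/funext => y; rewrite big_nil //.
case Pi : (P i); last first.
  under eq_fun do rewrite big_cons Pi.
  by under [X in is_diff_def _ _ X]eq_fun do rewrite big_cons Pi.
under eq_fun do rewrite big_cons Pi.
under [X in is_diff_def _ _ X]eq_fun do rewrite big_cons Pi.
by have := h i Pi => ?; exact: is_diffD.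
Qed.

Lemma is_diff_mul (F G dF dG : V -> R) x :
  is_diff x F dF -> is_diff x G dG ->
  is_diff x (fun y => F y * G y) (fun y => F x * dG y + G x * dF y).
Proof. by move=> hF hG; exact: is_diffM. Qed.

Lemma is_diff_continuous_linear (W : normedModType R) (f : {linear V -> W}) x :
  continuous f -> is_diff x f f.
Proof.
by move=> fc; apply: DiffDef; [exact: linear_differentiable | exact: diff_lin].
Qed.

Section ContinuouslyDifferentiable.
Variable D : set V.
Hypothesis openD : open D.

Lemma nearD x : D x -> \forall y \near x, D y.
Proof. by move=> Dx; exact: open_nbhs_nbhs. Qed.

(** D being open, a candidate derivative that is right at the points of D agrees
    with the true one near each of them, so continuity may be checked on it. *)
Lemma contdiff1_intro (W : normedModType R) (F : V -> W) (dF : V -> V -> W) :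
  (forall x, D x -> is_diff x F (dF x)) ->
  (forall Y x, D x -> {for x, continuous (fun y => dF y Y)}) ->
  contdiff 1 D F.
Proof.
move=> dFP dFc; split => [x Dx|Y x Dx].
  by have [] := dFP x Dx.
apply: near_eq_continuous (dFc Y x Dx).
by apply: filterS (nearD Dx) => y /dFP [_ ->].
Qed.

Lemma contdiff1_continuous (W : normedModType R) (F : V -> W) x :
  contdiff 1 D F -> D x -> {for x, continuous F}.
Proof. by move=> [Fd _] Dx; apply: differentiable_continuous; exact: Fd. Qed.

Lemma contdiff1_is_diff (W : normedModType R) (F : V -> W) x :
  contdiff 1 D F -> D x -> is_diff x F ('d F x).
Proof. by move=> [Fd _] Dx; apply: differentiableP; exact: Fd. Qed.

Lemma contdiff1_eq (W : normedModType R) (F G : V -> W) :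
  (forall x, D x -> F x = G x) -> contdiff 1 D F -> contdiff 1 D G.
Proof.
move=> FG [Fd Fc]; apply: (@contdiff1_intro _ _ (fun x => 'd F x)); last exact: Fc.
move=> x Dx; apply: near_eq_is_diff; last exact: Fd.
by apply: filterS (nearD Dx) => y /FG.
Qed.

Lemma contdiff1_cst (W : normedModType R) (w : W) : contdiff 1 D (fun _ => w).
Proof.
by apply: (@contdiff1_intro _ _ (fun _ _ => 0)) => Y x _; exact: cvg_cst.
Qed.

Lemma contdiff1_linear (W : normedModType R) (f : {linear V -> W}) :
  continuous f -> contdiff 1 D f.
Proof.
move=> fc; apply: (@contdiff1_intro _ _ (fun _ => f)) => [x _|Y x _].
  exact: is_diff_continuous_linear.
exact: cvg_cst.
Qed.

Lemma contdiff1_linear_comp (W W' : normedModType R) (f : {linear W -> W'})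
    (F : V -> W) :
  continuous f -> contdiff 1 D F -> contdiff 1 D (f \o F).
Proof.
move=> fc hF; apply: (@contdiff1_intro _ _ (fun x Y => f ('d F x Y))).
  move=> x Dx; have hf : is_diff (F x) f f.
    by apply: DiffDef; [exact: linear_differentiable | exact: diff_lin].
  exact: (@is_diff_comp _ _ _ _ _ _ _ _ _ (contdiff1_is_diff hF Dx) hf).
move=> Y x Dx; apply: (@continuous_comp _ _ _ (fun y => 'd F y Y) f).
  exact: hF.2.
exact: fc.
Qed.

Lemma contdiff1_sum (W : normedModType R) I (r : seq I) (P : pred I)
    (F : I -> V -> W) : (forall i, P i -> contdiff 1 D (F i)) ->
  contdiff 1 D (fun y => \sum_(i <- r | P i) F i y).
Proof.
move=> h; apply: (@contdiff1_intro _ _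
    (fun x Y => \sum_(i <- r | P i) 'd (F i) x Y)) => [x Dx|Y x Dx].
  by apply: is_diff_bigsum => i Pi; apply: contdiff1_is_diff => //; exact: h.
by apply: continuous_sum => i Pi; have [_] := h i Pi; exact.
Qed.

Lemma contdiff1_add (W : normedModType R) (F G : V -> W) :
  contdiff 1 D F -> contdiff 1 D G -> contdiff 1 D (fun y => F y + G y).
Proof.
move=> hF hG; apply: (@contdiff1_intro _ _ (fun x Y => 'd F x Y + 'd G x Y)).
  move=> x Dx; have ? := contdiff1_is_diff hF Dx.
  by have ? := contdiff1_is_diff hG Dx; exact: is_diffD.
by move=> Y x Dx; apply: cvgD; [apply: hF.2 | apply: hG.2].
Qed.

Lemma contdiff1_mul (F G : V -> R) :
  contdiff 1 D F -> contdiff 1 D G -> contdiff 1 D (fun y => F y * G y).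
Proof.
move=> hF hG; apply: (@contdiff1_intro _ _
    (fun x Y => F x * 'd G x Y + G x * 'd F x Y)).
  by move=> x Dx; apply: is_diff_mul; exact: contdiff1_is_diff.
move=> Y x Dx; apply: cvgD.
  by apply: cvgM; [exact: contdiff1_continuous hF Dx | apply: hG.2].
by apply: cvgM; [exact: contdiff1_continuous hG Dx | apply: hF.2].
Qed.

Lemma contdiff1_prod I (r : seq I) (P : pred I) (F : I -> V -> R) :
  (forall i, P i -> contdiff 1 D (F i)) ->
  contdiff 1 D (fun y => \prod_(i <- r | P i) F i y).
Proof.
move=> h; elim: r => [|i r IH].
  by under eq_fun do rewrite big_nil; exact: contdiff1_cst.
under eq_fun do rewrite big_cons.
case Pi : (P i); last exact: IH.
by apply: contdiff1_mul; [exact: h | exact: IH].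
Qed.

Lemma contdiff1_inv (F : V -> R) : contdiff 1 D F ->
  (forall x, D x -> F x != 0) -> contdiff 1 D (fun y => (F y)^-1).
Proof.
move=> hF F0; apply: (@contdiff1_intro _ _ (fun x Y => - (F x) ^- 2 * 'd F x Y)).
  move=> x Dx; apply: DiffDef.
    by apply: differentiableV; [exact: hF.1 | exact: F0].
  by rewrite diffV; [ | exact: hF.1 | exact: F0].
move=> Y x Dx; apply: cvgM; last exact: hF.2.
apply: cvgN; apply: cvgV; first by rewrite expf_eq0 F0.
exact: (contdiff1_continuous (contdiff1_mul hF hF) Dx).
Qed.

Lemma contdiff1_scale (W : normedModType R) (F : V -> R) (w : W) :
  contdiff 1 D F -> contdiff 1 D (fun y => F y *: w).
Proof.
move=> hF; apply: (@contdiff1_intro _ _ (fun x Y => 'd F x Y *: w)).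
  by move=> x Dx; apply: is_diff_scalar; exact: contdiff1_is_diff.
by move=> Y x Dx; apply: cvgZr_tmp; exact: hF.2.
Qed.

Lemma contdiff1_det m (M : V -> 'M[R]_m) :
  (forall i j, contdiff 1 D (fun x => M x i j)) ->
  contdiff 1 D (fun x => \det (M x)).
Proof.
move=> h; apply: contdiff1_sum => s _; apply: contdiff1_mul.
  exact: contdiff1_cst.
by apply: contdiff1_prod => i _.
Qed.

(** By Cramer's rule the entries of the inverse are quotients of polynomials in
    the entries. *)
Lemma contdiff1_invmx m (M : V -> 'M[R]_m) :
  (forall i j, contdiff 1 D (fun x => M x i j)) ->
  (forall x, D x -> M x \in unitmx) ->
  forall i j, contdiff 1 D (fun x => invmx (M x) i j).
Proof.
move=> h unitM i j.
apply: (@contdiff1_eq _ (fun x => (\det (M x))^-1 * cofactor (M x) j i)).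
  by move=> x Dx; rewrite /invmx unitM // !mxE.
apply: contdiff1_mul.
  apply: contdiff1_inv => [|x /unitM]; first exact: contdiff1_det.
  by rewrite unitmxE unitfE.
apply: contdiff1_mul; first exact: contdiff1_cst.
by apply: contdiff1_det => k l; under eq_fun do rewrite !mxE.
Qed.

Lemma contdiff1_mulmx m n p (A : V -> 'M[R]_(m, n)) (B : V -> 'M[R]_(n, p)) :
  (forall i j, contdiff 1 D (fun x => A x i j)) ->
  (forall i j, contdiff 1 D (fun x => B x i j)) ->
  forall i j, contdiff 1 D (fun x => (A x *m B x) i j).
Proof.
move=> hA hB i j; under eq_fun do rewrite mxE.
by apply: contdiff1_sum => k _; exact: contdiff1_mul.
Qed.

End ContinuouslyDifferentiable.

Lemma is_diff_mulmx m n p (A : V -> 'M[R]_(m, n)) (B : V -> 'M[R]_(n, p))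
    (dA : V -> 'M[R]_(m, n)) (dB : V -> 'M[R]_(n, p)) x :
  (forall i j, is_diff x (fun y => A y i j) (fun y => dA y i j)) ->
  (forall i j, is_diff x (fun y => B y i j) (fun y => dB y i j)) ->
  forall i j, is_diff x (fun y => (A y *m B y) i j)
                        (fun y => (dA y *m B x + A x *m dB y) i j).
Proof.
move=> hA hB i j; under eq_fun do rewrite mxE.
have -> : (fun y => (dA y *m B x + A x *m dB y) i j) =
    (fun y => \sum_k (A x i k * dB y k j + B x k j * dA y i k)).
  apply/funext => y; rewrite !mxE -big_split; apply: eq_bigr => k _.
  by rewrite addrC mulrC.
by apply: is_diff_bigsum => k _; exact: is_diff_mul.
Qed.

End Calculus.

(** * The space of symmetric matrices and the positive definite cone *)

Lemma near_dist (R : realType) (V : normedModType R) (x : V) e : 0 < e ->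
  \forall y \near x, `|y - x| < e.
Proof. by move=> e0; apply/nbhs_normP; exists e => // y /=; rewrite distrC. Qed.

Section SymmetricMatrices.
Variables (R : realType) (n : nat).
Implicit Types X Y Z P S : Sym R n.

Lemma symvalD X Y : symval (X + Y) = symval X + symval Y. Proof. by []. Qed.
Lemma symvalN X : symval (- X) = - symval X. Proof. by []. Qed.
Lemma symvalZ a X : symval (a *: X) = a *: symval X. Proof. by []. Qed.
Lemma symval0 : symval (0 : Sym R n) = 0. Proof. by []. Qed.

Lemma symval_sum I (r : seq I) (P : pred I) (F : I -> Sym R n) :
  symval (\sum_(i <- r | P i) F i) = \sum_(i <- r | P i) symval (F i).
Proof. exact: (big_morph _ symvalD symval0). Qed.

Lemma sym_tr X : (symval X)^T = symval X.
Proof. by apply/eqP; exact: symvalP. Qed.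

Lemma sym_inj X Y : symval X = symval Y -> X = Y.
Proof. exact: val_inj. Qed.

Lemma symC X i j : symval X i j = symval X j i.
Proof. by rewrite -[in LHS]sym_tr mxE. Qed.

Lemma frobE X Y : frob X Y = \sum_i \sum_j symval X i j * symval Y i j.
Proof.
rewrite /frob sym_tr /mxtrace; apply: eq_bigr => i _; rewrite mxE.
by apply: eq_bigr => j _; rewrite (symC Y).
Qed.

Lemma frobC X Y : frob X Y = frob Y X.
Proof.
by rewrite !frobE; do 2!apply: eq_bigr => ? _; rewrite mulrC.
Qed.

Lemma frob_linear X a Y Z : frob X (a *: Y + Z) = a * frob X Y + frob X Z.
Proof.
by rewrite /frob symvalD symvalZ mulmxDr -scalemxAr mxtraceD mxtraceZ.
Qed.

Lemma frob_is_linear X : linear (frob X).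
Proof. exact: frob_linear. Qed.

HB.instance Definition _ X :=
  GRing.isLinear.Build R (Sym R n) R _ (frob X) (frob_is_linear X).

Definition sym_entry i j X : R := symval X i j.

Lemma sym_entry_is_linear i j : linear (sym_entry i j).
Proof. by move=> a X Y; rewrite /sym_entry symvalD symvalZ !mxE. Qed.

HB.instance Definition _ i j :=
  GRing.isLinear.Build R (Sym R n) R _ (sym_entry i j) (sym_entry_is_linear i j).

Lemma sym_entry_le X i j : `|symval X i j| <= `|X|.
Proof. exact: entry_le_norm. Qed.

Lemma sym_entry_continuous i j : continuous (sym_entry i j).
Proof.
apply: bounded_linear_continuous; apply/linear_boundedP; near=> r => X.
rewrite /sym_entry; apply: (le_trans (sym_entry_le X i j)).
by rewrite ler_peMl.
Unshelve. all: by end_near. Qed.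

Lemma frob_continuous X : continuous (frob X).
Proof.
move=> Y; have -> : frob X = (fun Z => \sum_i \sum_j symval X i j * sym_entry i j Z).
  by apply/funext => Z; rewrite frobE.
apply: continuous_sum => i _; apply: continuous_sum => j _.
exact: (cvgM (@cvg_cst _ (symval X i j) _ (nbhs Y) _) (@sym_entry_continuous i j Y)).
Qed.

Lemma frob_ge0 X : 0 <= frob X X.
Proof. by rewrite frobE; do 2!apply: sumr_ge0 => ? _; rewrite -expr2 sqr_ge0. Qed.

Lemma frob_gt0 X : X != 0 -> 0 < frob X X.
Proof.
move=> X0; rewrite lt0r frob_ge0 andbT; apply: contra_neq X0; rewrite frobE => /eqP.
rewrite psumr_eq0; last by move=> i _; apply: sumr_ge0 => j _; rewrite -expr2 sqr_ge0.
move=> /allP h; apply: sym_inj; apply/matrixP => i j; rewrite symval0 mxE.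
have := h i (mem_index_enum _); rewrite /= psumr_eq0; last first.
  by move=> k _; rewrite -expr2 sqr_ge0.
by move=> /allP /(_ j (mem_index_enum _)) /=; rewrite mulf_eq0 orbb => /eqP.
Qed.

Definition qform (A : 'M[R]_n) (v : 'cV[R]_n) : R := (v^T *m A *m v) 0 0.

Lemma qformE A v : qform A v = \sum_i \sum_j v i 0 * A i j * v j 0.
Proof.
rewrite /qform mxE exchange_big /=; apply: eq_bigr => j _.
by rewrite mxE mulr_suml; apply: eq_bigr => i _; rewrite mxE.
Qed.

Lemma spectral_sym X : exists (Q : 'M[R]_n) (d : 'rV[R]_n),
  Q^T *m Q = 1%:M /\ symval X = Q *m diag_mx d *m Q^T.
Proof. exact: symm_spectral (sym_tr X). Qed.

Lemma qform_diag (Q : 'M[R]_n) (d : 'rV[R]_n) v :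
  qform (Q *m diag_mx d *m Q^T) v = \sum_i d 0 i * (Q^T *m v) i 0 ^+ 2.
Proof.
have -> : qform (Q *m diag_mx d *m Q^T) v = qform (diag_mx d) (Q^T *m v).
  by rewrite /qform trmx_mul trmxK !mulmxA.
rewrite qformE; apply: eq_bigr => i _; rewrite (bigD1 i) //= big1 => [|j ji].
  by rewrite addr0 [diag_mx _ _ _]mxE eqxx mulr1n expr2 mulrCA mulrA.
by rewrite [diag_mx _ _ _]mxE eq_sym (negbTE ji) mulr0n mulr0 mul0r.
Qed.

Lemma spd_eig_gt0 P (Q : 'M[R]_n) (d : 'rV[R]_n) : spd P ->
  Q^T *m Q = 1%:M -> symval P = Q *m diag_mx d *m Q^T -> forall i, 0 < d 0 i.
Proof.
move=> spdP QQ PE i; pose v : 'cV[R]_n := Q *m delta_mx i 0.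
have Qv : Q^T *m v = delta_mx i 0 by rewrite /v mulmxA QQ mul1mx.
have v0 : v != 0.
  apply: contra_neq (oner_neq0 R) => v0; move: Qv; rewrite v0 mulmx0.
  by move/matrixP/(_ i 0); rewrite !mxE !eqxx.
have := spdP v v0; rewrite -/(qform _ v) PE qform_diag Qv (bigD1 i) //= big1.
  by rewrite addr0 mxE !eqxx expr1n mulr1.
by move=> j ji; rewrite mxE (negbTE ji) expr0n mulr0.
Qed.

Lemma spd_of_eig P (Q : 'M[R]_n) (d : 'rV[R]_n) :
  Q^T *m Q = 1%:M -> symval P = Q *m diag_mx d *m Q^T ->
  (forall i, 0 < d 0 i) -> spd P.
Proof.
move=> QQ PE d0 v v0; rewrite -/(qform _ v) PE qform_diag.
have Qv : Q^T *m v != 0.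
  apply: contra_neq v0 => Qv; rewrite -[v]mul1mx -(mulmx1C QQ) -mulmxA Qv.
  by rewrite mulmx0.
have [i vi] : exists i, (Q^T *m v) i 0 != 0.
  apply/existsP; apply: contraNT Qv; rewrite negb_exists => /forallP h.
  apply/eqP/colP => i; rewrite [RHS]mxE; apply/eqP.
  by move: (h i); rewrite negbK.
rewrite (bigD1 i) //= ltr_pwDl //.
  by rewrite mulr_gt0 // exprn_even_gt0.
by apply: sumr_ge0 => j _; rewrite mulr_ge0 ?sqr_ge0 // ltW.
Qed.

Lemma spd_unitmx P : spd P -> symval P \in unitmx.
Proof.
move=> spdP; rewrite -row_free_unit; apply/row_freeP.
have [Q [d [QQ PE]]] := spectral_sym P; have d0 := spd_eig_gt0 spdP QQ PE.
exists (Q *m diag_mx (map_mx GRing.inv d) *m Q^T).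
rewrite PE !mulmxA -[_ *m Q^T *m Q]mulmxA QQ mulmx1.
rewrite -[_ *m diag_mx d *m _]mulmxA mulmx_diag.
rewrite (_ : diag_mx _ = 1%:M) ?mulmx1 ?(mulmx1C QQ) //.
rewrite -diag_const_mx; congr diag_mx; apply/rowP => i.
by rewrite !mxE divff // gt_eqF.
Qed.

Lemma sum_sqr_le (v : 'cV[R]_n) :
  \sum_i \sum_j `|v i 0| * `|v j 0| <= n%:R * \sum_i v i 0 ^+ 2.
Proof.
have -> : n%:R * \sum_i v i 0 ^+ 2 =
    \sum_(i < n) \sum_(j < n) (v i 0 ^+ 2 + v j 0 ^+ 2) / 2.
  transitivity (\sum_(i < n) (n%:R * v i 0 ^+ 2 + \sum_(j < n) v j 0 ^+ 2) / 2).
    rewrite -mulr_suml big_split /= -mulr_sumr sumr_const card_ord -mulr_natl.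
    by field.
  apply: eq_bigr => i _; rewrite -mulr_suml big_split /= sumr_const card_ord.
  by rewrite mulr_natl.
apply: ler_sum => i _; apply: ler_sum => j _.
rewrite -(real_normK (num_real (v i 0))) -(real_normK (num_real (v j 0))).
have := sqr_ge0 (`|v i 0| - `|v j 0|); rewrite sqrrB mulr2n; lra.
Qed.

Lemma qform_le (A : 'M[R]_n) v c : (forall i j, `|A i j| <= c) ->
  `|qform A v| <= c * (n%:R * \sum_i v i 0 ^+ 2).
Proof.
move=> Ac; have c0 i : v i 0 != 0 -> 0 <= c.
  by move=> _; apply: le_trans (Ac i i).
have [v0|[i vi]] : (forall i, v i 0 = 0) \/ (exists i, v i 0 != 0).
- case: (boolP [exists i, v i 0 != 0]) => [/existsP|]; first by right.
  rewrite negb_exists => /forallP h; left => i.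
  by apply/eqP; move: (h i); rewrite negbK.
- rewrite qformE big1 => [|i _]; last by rewrite big1 // => j _; rewrite v0 !mul0r.
  by rewrite big1 ?mulr0 ?normr0 // => i _; rewrite v0 expr0n.
have cge := c0 i vi.
apply: le_trans (ler_wpM2l cge (sum_sqr_le v)); rewrite qformE mulr_sumr.
apply: (le_trans (ler_norm_sum _ _ _)); apply: ler_sum => k _.
rewrite mulr_sumr; apply: (le_trans (ler_norm_sum _ _ _)).
apply: ler_sum => l _; rewrite !normrM mulrAC mulrC.
by rewrite ler_wpM2r // mulr_ge0.
Qed.

(** The quadratic form of P is at least c |v|^2, with c a lower bound of its
    eigenvalues, and a perturbation S - P changes it by at most
    n |S - P| |v|^2. *)
Lemma open_spd : open (@spd R n).
Proof.
rewrite openE => P spdP; have [Q [d [QQ PE]]] := spectral_sym P.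
have d0 := spd_eig_gt0 spdP QQ PE.
pose c := \big[Num.min/1]_i d 0 i.
have c0 : 0 < c by apply: lt_bigmin => // i _; exact: d0.
have cP (v : 'cV[R]_n) : c * (\sum_i v i 0 ^+ 2) <= qform (symval P) v.
  have E (u : 'cV[R]_n) : \sum_i u i 0 ^+ 2 = (u^T *m u) 0 0.
    by rewrite mxE; apply: eq_bigr => i _; rewrite mxE.
  have -> : \sum_i v i 0 ^+ 2 = \sum_i (Q^T *m v) i 0 ^+ 2.
    by rewrite !E trmx_mul trmxK -mulmxA [Q *m _]mulmxA (mulmx1C QQ) mul1mx.
  rewrite PE qform_diag mulr_sumr; apply: ler_sum => i _.
  by rewrite ler_wpM2r ?sqr_ge0 // bigmin_le_cond.
near=> S; move=> v v0; rewrite -/(qform _ v).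
have -> : symval S = symval P + symval (S - P) by rewrite -symvalD addrC subrK.
have SP : `|S - P| < c / n.+1%:R.
  by near: S; apply: near_dist; rewrite divr_gt0.
have s0 : 0 < \sum_i v i 0 ^+ 2.
  rewrite lt0r sumr_ge0 ?andbT; last by move=> i _; exact: sqr_ge0.
  apply: contra_neq v0 => /eqP; rewrite psumr_eq0; last by move=> i _; exact: sqr_ge0.
  move=> /allP h; apply/colP => i; rewrite mxE; apply/eqP.
  by rewrite -sqrf_eq0; exact: (h i (mem_index_enum _)).
have -> : qform (symval P + symval (S - P)) v =
          qform (symval P) v + qform (symval (S - P)) v.
  by rewrite /qform mulmxDr mulmxDl mxE.
have := qform_le v (@sym_entry_le (S - P)); rewrite ler_norml => /andP[h _].
have := cP v; set s := \sum_i _ in s0 h *.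
move: SP; rewrite ltr_pdivlMr // => SP h1.
have h2 : `|S - P| * (n%:R * s) < c * s.
  rewrite mulrA ltr_pM2r //; apply: le_lt_trans SP.
  by rewrite ler_wpM2l // ler_nat.
lra.
Unshelve. all: by end_near. Qed.

End SymmetricMatrices.

(** * The orthonormal basis attached to an orthogonal matrix *)

Section OrthonormalBasis.
Variables (R : realType) (n : nat) (Q : 'M[R]_n).
Hypothesis QQ : Q^T *m Q = 1%:M.
Implicit Types X Y Z P S : Sym R n.

Let QQt : Q *m Q^T = 1%:M. Proof. exact: mulmx1C. Qed.

(** The entries of Q^T X Q on and above the diagonal determine X. *)
Definition conj_coord X (k : basis_idx n) : R :=
  (Q^T *m symval X *m Q) (val k).1 (val k).2.

(** An off-diagonal entry occurs twice in the Frobenius product with a basis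
    element, whose entries are the inverse of the square root of 2. *)
Definition coord_scale (k : basis_idx n) : R :=
  if (val k).1 == (val k).2 then 1 else Num.sqrt 2.

Lemma coord_scale_neq0 k : coord_scale k != 0.
Proof.
rewrite /coord_scale; case: ifP => _; first exact: oner_neq0.
by rewrite sqrtr_eq0 -ltNge.
Qed.

Lemma conj_coord_inj X Y : (forall k, conj_coord X k = conj_coord Y k) -> X = Y.
Proof.
move=> XY.
have tr Z i j : (Q^T *m symval Z *m Q) i j = (Q^T *m symval Z *m Q) j i.
  rewrite -[in LHS](trmxK (_ *m Q)) mxE !trmx_mul trmxK sym_tr mulmxA.
  by [].
have {}XY : Q^T *m symval X *m Q = Q^T *m symval Y *m Q.
  apply/matrixP => i j; have [ij|ji] := leqP i j.
    exact: (XY (exist _ (i, j) ij)).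
  by rewrite tr [RHS]tr; exact: (XY (exist _ (j, i) (ltnW ji))).
apply: sym_inj.
have e Z : symval Z = Q *m (Q^T *m symval Z *m Q) *m Q^T.
  by rewrite !mulmxA QQt mul1mx -mulmxA QQt mulmx1.
by rewrite [LHS]e XY -e.
Qed.

Lemma mxtrace_delta m (M : 'M[R]_m) i j : \tr (delta_mx i j *m M) = M j i.
Proof.
rewrite /mxtrace (bigD1 i) //= big1 => [|k ki].
  rewrite addr0 mxE (bigD1 j) //= big1 => [|l lj].
    by rewrite addr0 mxE !eqxx mul1r.
  by rewrite mxE (negbTE lj) andbF mul0r.
by rewrite mxE big1 // => l _; rewrite mxE (negbTE ki) mul0r.
Qed.

Lemma frob_basis k X : frob (sym_basis Q k) X = coord_scale k * conj_coord X k.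
Proof.
rewrite /frob sym_tr /coord_scale /conj_coord /= /basis_mx.
set i := (val k).1; set j := (val k).2.
have sw (M : 'M[R]_n) :
    \tr (Q *m M *m Q^T *m symval X) = \tr (M *m (Q^T *m symval X *m Q)).
  by rewrite -!mulmxA mxtrace_mulC !mulmxA.
have XC : (Q^T *m symval X *m Q) j i = (Q^T *m symval X *m Q) i j.
  by rewrite -[in LHS](trmxK (_ *m Q)) mxE !trmx_mul trmxK sym_tr mulmxA.
case: ifP => [/eqP ij|_].
  by rewrite sw mxtrace_delta mul1r ij.
rewrite -scalemxAl mxtraceZ sw mulmxDl mxtraceD !mxtrace_delta XC.
set x := (_ *m _) i j; rewrite -mulr2n -(mulr_natl x 2) mulrA; congr (_ * _).
have s0 : Num.sqrt 2 != 0 :> R by rewrite sqrtr_eq0 -ltNge.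
by apply: (mulfI s0); rewrite mulrA mulfV // mul1r -expr2 sqr_sqrtr.
Qed.

Lemma conj_coord_basis k l :
  conj_coord (sym_basis Q k) l = (k == l)%:R / coord_scale k.
Proof.
rewrite /conj_coord /= /basis_mx /coord_scale.
case: k l => -[i j] /= ij [[a b] /= ab].
have -> : (exist _ (i, j) ij == exist _ (a, b) ab :> basis_idx n) =
          ((i == a) && (j == b)) by rewrite -val_eqE /= xpair_eqE.
have cj (M : 'M[R]_n) : Q^T *m (Q *m M *m Q^T) *m Q = M.
  by rewrite !mulmxA QQ mul1mx -mulmxA QQ mulmx1.
case: ifP => [/eqP <-|ijE].
  by rewrite cj mxE divr1 (eq_sym a) (eq_sym b).
rewrite -scalemxAr -scalemxAl cj [LHS]mxE.
have -> : (delta_mx i j + delta_mx j i) a b = ((i == a) && (j == b))%:R :> R.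
  rewrite !mxE (eq_sym i) (eq_sym j) [(a == j) && _](_ : _ = false) ?addr0 //.
  apply/negbTE/negP => /andP[/eqP aj /eqP bi]; subst a b.
  by move: ijE; rewrite -val_eqE /= eqn_leq ij ab.
by rewrite mulrC.
Qed.

Lemma frob_basis_ortho k l : frob (sym_basis Q k) (sym_basis Q l) = (k == l)%:R.
Proof.
rewrite frob_basis conj_coord_basis eq_sym.
by case: eqP => [->|_]; rewrite ?mul0r ?mulr0 // mul1r divff // coord_scale_neq0.
Qed.

Lemma basis_expansion X : X = \sum_k frob (sym_basis Q k) X *: sym_basis Q k.
Proof.
apply: conj_coord_inj => l.
have cl : conj_coord (\sum_k frob (sym_basis Q k) X *: sym_basis Q k) l =
    \sum_k frob (sym_basis Q k) X * conj_coord (sym_basis Q k) l.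
  rewrite /conj_coord symval_sum mulmx_sumr mulmx_suml summxE.
  by apply: eq_bigr => k _; rewrite symvalZ -scalemxAr -scalemxAl mxE.
rewrite cl (bigD1 l) //= big1 => [|k /negbTE kl].
  rewrite addr0 frob_basis conj_coord_basis eqxx mul1r mulrAC.
  by rewrite divff ?mul1r // coord_scale_neq0.
by rewrite conj_coord_basis kl mul0r mulr0.
Qed.

Definition ebasis (i : 'I_#|basis_idx n|) : Sym R n := sym_basis Q (enum_val i).

Lemma ebasis_ortho i j : frob (ebasis i) (ebasis j) = (i == j)%:R.
Proof. by rewrite frob_basis_ortho (inj_eq enum_val_inj). Qed.

Lemma ebasis_expansion X : X = \sum_i frob (ebasis i) X *: ebasis i.
Proof.
rewrite [LHS]basis_expansion (reindex (@enum_val (basis_idx n) predT)) //=.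
by apply: onW_bij; exact: enum_val_bij.
Qed.

Lemma frob_ebasis_sum (u : 'I_#|basis_idx n| -> R) i :
  frob (ebasis i) (\sum_j u j *: ebasis j) = u i.
Proof.
rewrite linear_sum (bigD1 i) //= big1 => [|j ji].
  by rewrite addr0 linearZ /= ebasis_ortho eqxx [LHS]mulr1.
by rewrite linearZ /= ebasis_ortho eq_sym (negbTE ji) [LHS]mulr0.
Qed.

Lemma linear_ebasis (W : lmodType R) (f : {linear Sym R n -> W}) X :
  f X = \sum_i frob (ebasis i) X *: f (ebasis i).
Proof.
rewrite {1}(ebasis_expansion X) linear_sum.
by apply: eq_bigr => i _; rewrite linearZ.
Qed.

Lemma is_diff_frob_coords (V : normedModType R) (F : V -> Sym R n)
    (dF : V -> Sym R n) x :
  (forall i, is_diff x (fun y => frob (ebasis i) (F y))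
                       (fun y => frob (ebasis i) (dF y))) ->
  is_diff x F dF.
Proof.
move=> h.
have -> : F = (fun y => \sum_i frob (ebasis i) (F y) *: ebasis i).
  by apply/funext => y; exact: ebasis_expansion.
have -> : dF = (fun y => \sum_i frob (ebasis i) (dF y) *: ebasis i).
  by apply/funext => y; exact: ebasis_expansion.
by apply: is_diff_bigsum => i _; exact: is_diff_scalar.
Qed.

Lemma differentiable_entries (V : normedModType R) (F : V -> Sym R n) x :
  (forall i j, differentiable (fun y => symval (F y) i j) x) ->
  differentiable F x.
Proof.
move=> h.
have -> : F = (fun y => \sum_k frob (ebasis k) (F y) *: ebasis k).
  by apply/funext => y; exact: ebasis_expansion.
apply: is_diff_ex; apply: is_diff_bigsum => k _; apply: is_diff_scalar.
have -> : (fun y => frob (ebasis k) (F y)) =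
    (fun y => \sum_i \sum_j symval (ebasis k) i j * symval (F y) i j).
  by apply/funext => y; rewrite frobE.
apply: is_diff_bigsum => i _; apply: is_diff_bigsum => j _.
by apply: is_diffZ; exact: differentiableP (h i j).
Qed.

Lemma is_diff_entries (V : normedModType R) (F : V -> Sym R n)
    (dF : V -> Sym R n) x :
  (forall i j, is_diff x (fun y => symval (F y) i j)
                         (fun y => symval (dF y) i j)) ->
  is_diff x F dF.
Proof.
move=> h; apply: is_diff_frob_coords => k.
have e (G : V -> Sym R n) : (fun y => frob (ebasis k) (G y)) =
    (fun y => \sum_i \sum_j symval (ebasis k) i j * symval (G y) i j).
  by apply/funext => y; rewrite frobE.
by rewrite !e; apply: is_diff_bigsum => i _; apply: is_diff_bigsum => j _.
Qed.

End OrthonormalBasis.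

(** * Riemannian metrics, their connections, and Hessians at critical points *)

Section RiemannianMetrics.
Variables (R : realType) (n : nat).
Implicit Types (g : metric R n) (X Y Z P S u v w : Sym R n).

Record riemannian g : Prop := Riemannian {
  metric_linear : forall P, spd P -> forall a X Y Z,
    g P (a *: X + Y) Z = a * g P X Z + g P Y Z;
  metric_sym : forall P, spd P -> forall X Y, g P X Y = g P Y X;
  metric_gt0 : forall P, spd P -> forall X, X != 0 -> 0 < g P X X;
  metric_C1 : forall X Y, contdiff 1 (@spd R n) (fun P => g P X Y) }.

Let E := @ebasis R n 1%:M.
Let N := #|basis_idx n|.

Let Q1 : (1%:M : 'M[R]_n)^T *m 1%:M = 1%:M.
Proof. by rewrite trmx1 mulmx1. Qed.

Section Metric.
Variable g : metric R n.
Hypothesis gR : riemannian g.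

Lemma metricDl P X Y Z : spd P -> g P (X + Y) Z = g P X Z + g P Y Z.
Proof. by move=> sP; rewrite -[X]scale1r metric_linear // !mul1r scale1r. Qed.

Lemma metricDr P X Y Z : spd P -> g P Z (X + Y) = g P Z X + g P Z Y.
Proof. by move=> sP; rewrite !(metric_sym gR sP Z) metricDl. Qed.

Lemma metric0l P Z : spd P -> g P 0 Z = 0.
Proof.
by move=> sP; apply: (@addIr _ (g P 0 Z)); rewrite -metricDl // addr0 add0r.
Qed.

Lemma metricZl P a X Z : spd P -> g P (a *: X) Z = a * g P X Z.
Proof. by move=> sP; rewrite -[a *: X]addr0 metric_linear // metric0l // addr0. Qed.

Lemma metric_suml P I (r : seq I) (F : I -> Sym R n) Z : spd P ->
  g P (\sum_(i <- r) F i) Z = \sum_(i <- r) g P (F i) Z.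
Proof.
move=> sP; elim: r => [|i r IH]; first by rewrite !big_nil metric0l.
by rewrite !big_cons metricDl // IH.
Qed.

Lemma metric_expansion P X Y : spd P ->
  g P X Y = \sum_i \sum_j frob (E i) X * frob (E j) Y * g P (E i) (E j).
Proof.
move=> sP; rewrite {1}(ebasis_expansion Q1 X) metric_suml //.
apply: eq_bigr => i _; rewrite metricZl // metric_sym //.
rewrite {1}(ebasis_expansion Q1 Y) metric_suml // mulr_sumr.
apply: eq_bigr => j _; rewrite metricZl // metric_sym // mulrA //.
Qed.

Lemma metric_inj P X Y : spd P -> (forall Z, g P X Z = g P Y Z) -> X = Y.
Proof.
move=> sP XY; apply/eqP; rewrite -subr_eq0; apply/negPn/negP => XY0.
have := metric_gt0 gR sP XY0.
by rewrite metricDl // -scaleN1r metricZl // XY mulN1r subrr ltxx.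
Qed.

Definition gram P : 'M[R]_N := \matrix_(i, j) g P (E i) (E j).

Lemma gram_unitmx P : spd P -> gram P \in unitmx.
Proof.
move=> sP; rewrite -row_free_unit -kermx_eq0.
apply/rowV0P => x /sub_kermxP xG; pose X := \sum_i x 0 i *: E i.
have gX j : g P X (E j) = 0.
  move/rowP: xG => /(_ j); rewrite !mxE => <-.
  by rewrite metric_suml //; apply: eq_bigr => i _; rewrite metricZl // mxE.
have X0 : X = 0.
  apply: (metric_inj sP) => Z; rewrite metric0l // metric_expansion //.
  rewrite exchange_big /= big1 // => j _.
  transitivity (frob (E j) Z * g P X (E j)); last by rewrite gX mulr0.
  rewrite [in RHS](ebasis_expansion Q1 X) metric_suml // mulr_sumr.
  by apply: eq_bigr => i _; rewrite metricZl // mulrA [_ * frob _ Z]mulrC.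
apply/rowP => i; rewrite mxE -[LHS](frob_ebasis_sum Q1 (fun i => x 0 i) i).
by rewrite -/E -/X X0 linear0.
Qed.

(** Riesz representation for the inner product g_P, in coordinates: inverting
    the Gram matrix makes representers as regular in P as the metric and the
    form are. *)
Definition representer P (l : Sym R n -> R) : Sym R n :=
  \sum_i (\sum_j l (E j) * invmx (gram P) j i) *: E i.

Lemma representerP P (l : Sym R n -> R) Y : spd P -> linear l ->
  g P (representer P l) Y = l Y.
Proof.
move=> sP llin.
pose L : {linear Sym R n -> R} := HB.pack l (GRing.isLinear.Build _ _ _ _ _ llin).
have -> : l Y = L Y by [].
rewrite (linear_ebasis Q1 L Y) metric_sym //.
rewrite {1}(ebasis_expansion Q1 Y) metric_suml //; apply: eq_bigr => k _.
rewrite metricZl //; congr (_ * _); rewrite metric_sym // metric_suml //.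
transitivity (((\row_j l (E j)) *m invmx (gram P) *m gram P) 0 k).
  rewrite mxE; apply: eq_bigr => i _; rewrite metricZl //; congr (_ * _).
    by rewrite mxE; apply: eq_bigr => j _; rewrite mxE.
  by rewrite mxE.
by rewrite mulmxKV ?gram_unitmx // mxE.
Qed.

Lemma rgradE f P : spd P -> rgrad g f P = representer P ('d f P).
Proof.
move=> sP; rewrite /rgrad.
have ex : [set G | forall Y, g P G Y = 'd f P Y] (representer P ('d f P)).
  by move=> Y; apply: representerP => //; exact: linearP.
have := @xgetPex _ 0 _ (ex_intro _ _ ex) => /= h.
by apply: (metric_inj sP) => Y; rewrite h ex.
Qed.

Lemma rgradP f P Y : spd P -> g P (rgrad g f P) Y = 'd f P Y.
Proof. by move=> sP; rewrite rgradE // representerP //; exact: linearP. Qed.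

Lemma representer_C1 (l : Sym R n -> Sym R n -> R) :
  (forall Z, contdiff 1 (@spd R n) (fun P => l P Z)) ->
  contdiff 1 (@spd R n) (fun P => representer P (l P)).
Proof.
move=> lC1; apply: contdiff1_sum => [|i _]; first exact: open_spd.
apply: contdiff1_scale; first exact: open_spd.
apply: contdiff1_sum => [|j _]; first exact: open_spd.
apply: contdiff1_mul; first exact: open_spd.
  exact: lC1.
apply: contdiff1_invmx; [exact: open_spd | | exact: gram_unitmx].
move=> k l'; apply: (contdiff1_eq (@open_spd R n)); last first.
  exact: (metric_C1 gR (E k) (E l')).
by move=> P _; rewrite mxE.
Qed.

Lemma rgrad_C1 f : contdiff 2 (@spd R n) f -> contdiff 1 (@spd R n) (rgrad g f).
Proof.
move=> [_ f2].
apply: (contdiff1_eq (@open_spd R n) (F := fun P => representer P ('d f P))).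
  by move=> P sP; rewrite rgradE.
exact: (@representer_C1 (fun P => 'd f P)).
Qed.

(** Opaque, so that equalities between derivatives of the metric are decided by
    their algebraic properties and never by unfolding. *)
Fact dmetric_seal : {dm : Sym R n -> Sym R n -> Sym R n -> Sym R n -> R |
  forall P u v w, dm P u v w = 'd (fun S => g S v w) P u}.
Proof. by exists (fun P u v w => 'd (fun S => g S v w) P u). Qed.

Definition dmetric := sval dmetric_seal.

Lemma dmetricE P u v w : dmetric P u v w = 'd (fun S => g S v w) P u.
Proof. exact: (svalP dmetric_seal). Qed.

Lemma metric_const_diff P v w : spd P ->
  is_diff P (fun S => g S v w) (fun u => dmetric P u v w).
Proof.
move=> sP; under [X in is_diff_def _ _ X]eq_fun do rewrite dmetricE.
exact: contdiff1_is_diff (metric_C1 gR v w) sP.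
Qed.

Lemma dmetric_near P u v w (F : Sym R n -> R) dF :
  (\forall S \near P, g S v w = F S) -> spd P -> is_diff P F dF ->
  dmetric P u v w = dF u.
Proof.
move=> e sP hF; have e' : \forall S \near P, F S = g S v w.
  by apply: filterS e => S ->.
have [_ h] := near_eq_is_diff e' (is_diff_ex hF).
by rewrite dmetricE -(is_diff_val u hF) -h.
Qed.

Lemma dmetric_linear_dir P a u u' v w :
  dmetric P (a *: u + u') v w = a * dmetric P u v w + dmetric P u' v w.
Proof. by rewrite !dmetricE linearP. Qed.

Lemma dmetric_sym P u v w : spd P -> dmetric P u v w = dmetric P u w v.
Proof.
move=> sP; apply: (dmetric_near u _ sP (metric_const_diff w v sP)).
by apply: filterS (nearD (@open_spd R n) sP) => S sS; rewrite (metric_sym gR sS).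
Qed.

Lemma dmetric_linear P u a v v' w : spd P ->
  dmetric P u (a *: v + v') w = a * dmetric P u v w + dmetric P u v' w.
Proof.
move=> sP; pose F S := a * g S v w + g S v' w.
have hF : is_diff P F (fun u => a * dmetric P u v w + dmetric P u v' w).
  have h1 := metric_const_diff v w sP; have h2 := metric_const_diff v' w sP.
  by apply: is_diffD; exact: is_diffZ.
apply: (dmetric_near u _ sP hF).
by apply: filterS (nearD (@open_spd R n) sP) => S sS; rewrite (metric_linear gR sS).
Qed.

Lemma dmetric_linear_r P u a v v' w : spd P ->
  dmetric P u w (a *: v + v') = a * dmetric P u w v + dmetric P u w v'.
Proof. by move=> sP; rewrite !(dmetric_sym _ w) // dmetric_linear. Qed.

(** Christoffel symbols of the first kind in the global chart Sym(n). *)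
Definition koszul P u v w : R :=
  (dmetric P u v w + dmetric P v u w - dmetric P w u v) / 2.

Definition christoffel P u v : Sym R n := representer P (koszul P u v).

Lemma christoffelP P u v w : spd P ->
  g P (christoffel P u v) w = koszul P u v w.
Proof.
move=> sP; apply: representerP => // a x y.
rewrite /koszul dmetric_linear_dir !dmetric_linear_r //.
by rewrite -[a *: _]/(a * _); ring.
Qed.

Lemma christoffel_sym P u v : spd P -> christoffel P u v = christoffel P v u.
Proof.
move=> sP; apply: (metric_inj sP) => w; rewrite !christoffelP // /koszul.
by rewrite (dmetric_sym _ u v) // (addrC (dmetric P u v w)).
Qed.

Lemma christoffel_linear P a u u' v : spd P ->
  christoffel P (a *: u + u') v = a *: christoffel P u v + christoffel P u' v.
Proof.
move=> sP; apply: (metric_inj sP) => w.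
rewrite metric_linear // !christoffelP // /koszul dmetric_linear_dir.
by rewrite !dmetric_linear //; field.
Qed.

Lemma christoffel_metric P u v w : spd P ->
  dmetric P u v w = g P (christoffel P u v) w + g P v (christoffel P u w).
Proof.
move=> sP; rewrite (metric_sym gR sP v) !christoffelP // /koszul.
by rewrite (dmetric_sym u w v sP); field.
Qed.

(** The metric is bilinear on the cone only, so the product rule is obtained
    from the expansion in coordinates, which is valid near P. *)
Lemma metric_diff P (Y Z : Sym R n -> Sym R n) X : spd P ->
  differentiable Y P -> differentiable Z P ->
  'd (fun S => g S (Y S) (Z S)) P X =
    dmetric P X (Y P) (Z P) + g P ('d Y P X) (Z P) + g P (Y P) ('d Z P X).
Proof.
move=> sP dY dZ.
have comp (F : Sym R n -> Sym R n) i : differentiable F P ->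
    is_diff P (fun S => frob (E i) (F S)) (fun u => frob (E i) ('d F P u)).
  move=> dF; have h := differentiableP dF.
  have h' := is_diff_continuous_linear (F P) (@frob_continuous R n (E i)).
  exact: (@is_diff_comp _ _ _ _ F ('d F P) (frob (E i)) (frob (E i)) P h h').
have e : \forall S \near P,
    \sum_i \sum_j frob (E i) (Y S) * frob (E j) (Z S) * g S (E i) (E j) =
    g S (Y S) (Z S).
  by apply: filterS (nearD (@open_spd R n) sP) => S sS; rewrite -metric_expansion.
have h : is_diff P
    (fun S => \sum_i \sum_j frob (E i) (Y S) * frob (E j) (Z S) * g S (E i) (E j))
    (fun u => \sum_i \sum_j
      (frob (E i) (Y P) * frob (E j) (Z P) * dmetric P u (E i) (E j) +
       g P (E i) (E j) * (frob (E i) (Y P) * frob (E j) ('d Z P u) +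
                          frob (E j) (Z P) * frob (E i) ('d Y P u)))).
  apply: is_diff_bigsum => i _; apply: is_diff_bigsum => j _.
  have hY := comp Y i dY; have hZ := comp Z j dZ.
  exact: is_diff_mul (is_diff_mul hY hZ) (metric_const_diff (E i) (E j) sP).
have [_ ->] := near_eq_is_diff e (is_diff_ex h).
rewrite (is_diff_val _ h).
rewrite [in g P ('d Y P X) _]metric_expansion // [g P (Y P) _]metric_expansion //.
have -> : dmetric P X (Y P) (Z P) =
    \sum_i \sum_j frob (E i) (Y P) * frob (E j) (Z P) * dmetric P X (E i) (E j).
  have h' : is_diff P
      (fun S => \sum_i \sum_j frob (E i) (Y P) * frob (E j) (Z P) * g S (E i) (E j))
      (fun u => \sum_i \sum_j
        frob (E i) (Y P) * frob (E j) (Z P) * dmetric P u (E i) (E j)).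
    apply: is_diff_bigsum => i _; apply: is_diff_bigsum => j _.
    have := metric_const_diff (E i) (E j) sP => ?; exact: is_diffZ.
  apply: (dmetric_near X _ sP h').
  by apply: filterS (nearD (@open_spd R n) sP) => S sS; rewrite -metric_expansion.
rewrite -!big_split; apply: eq_bigr => i _; rewrite -!big_split /=.
apply: eq_bigr => j _.
move: (frob (E i) (Y P)) (frob (E j) (Z P)) (frob (E i) ('d Y P X))
  (frob (E j) ('d Z P X)) (g P (E i) (E j)) (dmetric P X (E i) (E j)).
by move=> *; ring.
Qed.

Definition koszul_connection (Y X : Sym R n -> Sym R n) P : Sym R n :=
  'd X P (Y P) + christoffel P (Y P) (X P).

(** With the Christoffel symbols of Koszul's formula, symmetry of the symbols
    gives the absence of torsion and christoffel_metric gives compatibility. *)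
Lemma koszul_connectionP : is_levi_civita g koszul_connection.
Proof.
have clr P u a v v' : spd P ->
    christoffel P u (a *: v + v') = a *: christoffel P u v + christoffel P u v'.
  by move=> sP; rewrite !(christoffel_sym u) // christoffel_linear.
have c0 P u : spd P -> christoffel P u 0 = 0.
  move=> sP; have := clr P u 1 0 0 sP; rewrite !scale1r addr0.
  by move=> h; apply: (@addIr _ (christoffel P u 0)); rewrite -h add0r.
split; rewrite /koszul_connection.
- move=> phi Y Y' X _ _ _ _ P sP.
  by rewrite linearP christoffel_linear // scalerDr addrACA.
- move=> Y X X' _ hX hX' P sP.
  have h1 := contdiff1_is_diff hX sP; have h2 := contdiff1_is_diff hX' sP.
  have hD : 'd (fun S => X S + X' S) P (Y P) = 'd X P (Y P) + 'd X' P (Y P).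
    exact: (is_diff_val (Y P) (is_diffD h1 h2)).
  have hC := clr P (Y P) 1 (X P) (X' P) sP; rewrite !scale1r in hC.
  exact: (etrans (congr2 +%R hD hC) (addrACA _ _ _ _)).
- move=> phi Y X hphi _ hX P sP.
  have h1 := contdiff1_is_diff hphi sP; have h2 := contdiff1_is_diff hX sP.
  have h : is_diff P (fun S => phi S *: X S)
      (fun u => 'd phi P u *: X P + phi P *: 'd X P u).
    apply: (is_diff_entries Q1) => i j.
    have hij : is_diff P (fun S => symval (X S) i j)
                         (fun u => symval ('d X P u) i j).
      have h' := is_diff_continuous_linear (X P) (@sym_entry_continuous R n i j).
      exact: (@is_diff_comp _ _ _ _ X ('d X P) (sym_entry i j) (sym_entry i j)
        P h2 h').
    have hm := is_diff_mul h1 hij.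
    have -> : (fun y => symval (phi y *: X y) i j) =
        (fun y => phi y * symval (X y) i j).
      by apply/funext => S; rewrite symvalZ mxE.
    have -> : (fun u => symval ('d phi P u *: X P + phi P *: 'd X P u) i j) =
        (fun u => phi P * symval ('d X P u) i j + symval (X P) i j * 'd phi P u).
      apply/funext => u; rewrite symvalD !symvalZ !mxE addrC; congr (_ + _).
      exact: mulrC.
    exact: hm.
  have hD := is_diff_val (Y P) h.
  have hC := clr P (Y P) (phi P) (X P) 0 sP; rewrite addr0 c0 // addr0 in hC.
  apply: (etrans (congr2 +%R hD hC)).
  by rewrite -addrA -scalerDr.
- move=> X Y _ _ P sP; rewrite (christoffel_sym (Y P) (X P) sP).
  have cancel_r (a b c : Sym R n) : a + c - (b + c) = a - b.
    by rewrite opprD addrACA subrr addr0.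
  exact: cancel_r.
- move=> X Y Z _ hY hZ P sP.
  have hD := metric_diff (X P) sP (hY.1 P sP) (hZ.1 P sP).
  apply: (etrans hD); rewrite (christoffel_metric _ _ _ sP).
  apply: (etrans _ (esym (congr2 +%R (metricDl _ _ _ sP) (metricDr _ _ _ sP)))).
  have swap (a b c e : R) : a + b + c + e = c + a + (e + b) by ring.
  exact: swap.
Qed.

Lemma levi_civitaP : is_levi_civita g (levi_civita g).
Proof.
exact: (@xgetPex _ (fun _ _ _ => 0) [set nabla | is_levi_civita g nabla]
  (ex_intro _ _ koszul_connectionP)).
Qed.

Definition hessian_form (f : Sym R n -> R) P Y Z : R :=
  'd (fun S => 'd f S Z) P Y.

(** At a critical point the gradient vanishes, so metric compatibility applied
    to grad f and a constant field leaves only the second derivative of f. *)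
Lemma rhess_critical f P Y Z : contdiff 2 (@spd R n) f -> spd P ->
  (forall X, 'd f P X = 0) -> g P (rhess g f P Y) Z = hessian_form f P Y Z.
Proof.
move=> f2 sP crit; have oS := @open_spd R n.
have grad0 : rgrad g f P = 0.
  by apply: (metric_inj sP) => X; rewrite rgradP // crit metric0l.
have := nabla_metric levi_civitaP (contdiff1_cst oS Y) (rgrad_C1 f2)
  (contdiff1_cst oS Z) sP.
rewrite -/(rhess g f P Y) grad0 metric0l // addr0 => <-.
have e : \forall S \near P, 'd f S Z = g S (rgrad g f S) Z.
  by apply: filterS (nearD oS sP) => S sS; exact: (esym (rgradP f Z sS)).
have [_ f2'] := f2.
have [fZ _] := f2' Z.
by have [_ h] := near_eq_is_diff e (fZ P sP); exact: (congr1 (@^~ Y) h).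
Qed.

End Metric.

Lemma frob_riemannian : riemannian (fun _ => @frob R n).
Proof.
split.
- by move=> P _ a X Y Z; rewrite frobC frob_linear !(frobC Z).
- by move=> P _ X Y; exact: frobC.
- by move=> P _ X; exact: frob_gt0.
- by move=> X Y; apply: contdiff1_cst; exact: open_spd.
Qed.

Lemma ehess_form f P Y Z : contdiff 2 (@spd R n) f -> spd P ->
  frob (ehess f P Y) Z = hessian_form f P Y Z.
Proof.
move=> f2 sP; have gC1 := rgrad_C1 frob_riemannian f2.
have e : \forall S \near P, 'd f S Z = frob (egrad f S) Z.
  apply: filterS (nearD (@open_spd R n) sP) => S sS.
  by rewrite -(rgradP frob_riemannian).
have [_ f2'] := f2; have [fZ _] := f2' Z.
have [_ h] := near_eq_is_diff e (fZ P sP); rewrite /hessian_form -h.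
have h1 := contdiff1_is_diff gC1 sP.
have h2 := is_diff_continuous_linear (egrad f P) (@frob_continuous R n Z).
have h3 := @is_diff_comp _ _ _ _ (egrad f) ('d (egrad f) P) (frob Z) (frob Z) P h1 h2.
rewrite [frob _ _]frobC -[LHS]/((frob Z \o 'd (egrad f) P) Y).
rewrite -(is_diff_val _ h3); congr ('d _ P Y).
by apply/funext => S; rewrite /= frobC.
Qed.

End RiemannianMetrics.

(** * Local minima and symmetry of the second derivative *)

Section SecondDerivative.
Variables (R : realType) (V : normedModType R).
Implicit Types (x v w : V) (f : V -> R).

Lemma near_ball_ex (Q : V -> Prop) x : (\forall y \near x, Q y) ->
  exists2 r : R, 0 < r & forall w, `|w| < r -> Q (x + w).
Proof.
move=> /nbhs_normP [r r0 rQ]; exists r => // w wr; apply: rQ => /=.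
by rewrite opprD addrA subrr add0r normrN.
Qed.

Lemma is_derive_line f x v (s : R) : differentiable f (x + s *: v) ->
  is_derive s 1 (fun t => f (x + t *: v)) ('d f (x + s *: v) v).
Proof.
move=> df.
have h1 : is_diff s (fun t : R => x + t *: v) (fun t => 0 + t *: v).
  exact: (is_diffD (is_diff_cst x s) (is_diff_scalel s v)).
have h2 := @is_diff_comp _ _ _ _ _ _ _ _ _ h1 (differentiableP df).
have dc := is_diff_ex h2.
apply: DeriveDef; first exact: diff_derivable.
rewrite deriveE //; apply: (etrans (is_diff_val _ h2)).
by rewrite /= add0r scale1r.
Qed.

(** A negative derivative along v would make f decrease for short steps; a
    positive one is excluded by stepping along - v. *)
Lemma local_min_diff0 f x v : differentiable f x ->
  (\forall y \near x, f x <= f y) -> 'd f x v = 0.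
Proof.
move=> df fmin.
have ge0 u : 0 <= 'd f x u.
  rewrite leNgt; apply/negP => u0.
  have un0 : u != 0 by apply: contraTneq u0 => ->; rewrite linear0 ltxx.
  have nu : 0 < `|u| by rewrite normr_gt0.
  have e0 : 0 < - 'd f x u / (2 * `|u|) by rewrite divr_gt0 ?oppr_gt0 ?mulr_gt0.
  have [r r0 h] := near_ball_ex (filterI fmin (diff_eps df e0)).
  pose t := r / (2 * `|u|); have t0 : 0 < t by rewrite divr_gt0 ?mulr_gt0.
  have tur : `|t *: u| = r / 2.
    by rewrite normrZ gtr0_norm // /t; field; rewrite gt_eqF.
  have lin : 'd f x (t *: u) = t * 'd f x u by exact: linearZ.
  have [] := h (t *: u); first by rewrite tur ltr_pdivrMr // mulr2n mulrDr mulr1 ltrDl.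
  rewrite [x + _]addrC addrK lin tur => h1.
  rewrite ler_norml => /andP[_].
  have -> : - 'd f x u / (2 * `|u|) * (r / 2) = - 'd f x u * t / 2.
    by rewrite /t; field; rewrite gt_eqF.
  have : 'd f x u * t < 0 by rewrite nmulr_rlt0.
  by lra.
apply/eqP; rewrite eq_le ge0 andbT -oppr_ge0.
by have := ge0 (- v); rewrite linearN.
Qed.

(** By the mean value theorem the second difference
    f(x+tv+tw) - f(x+tv) - f(x+tw) + f(x) is t^2 times the second derivative,
    up to o(t^2); it is symmetric in v and w. *)
Lemma second_difference (D : set V) f x v w : open D -> D x ->
  (forall y, D y -> differentiable f y) ->
  differentiable (fun y => 'd f y w) x -> forall e, 0 < e ->
  exists2 r : R, 0 < r & forall t, 0 < t -> t < r ->
    `|f (x + t *: v + t *: w) - f (x + t *: v) - (f (x + t *: w) - f x)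
      - t ^+ 2 * 'd (fun y => 'd f y w) x v| <= e * t ^+ 2.
Proof.
move=> oD Dx fD dh e e0; set h := fun y => 'd f y w in dh *.
(* |tv + sw| + |sw| <= c t for s in [0, t]. *)
pose c := `|v| + 2 * `|w| + 1.
have c0 : 0 < c by rewrite ltr_wpDl // addr_ge0 // mulr_ge0.
have [r0 r00 hr] := near_ball_ex (filterI (nearD oD Dx) (diff_eps dh (divr_gt0 e0 c0))).
exists (r0 / c); first by rewrite divr_gt0.
move=> t t0; rewrite ltr_pdivlMr // => tr.
have small s a : 0 <= s <= t -> 0 <= a <= t -> `|a *: v + s *: w| < r0.
  move=> /andP[s0 st] /andP[a0 at']; apply: le_lt_trans tr.
  rewrite (le_trans (ler_normD _ _)) // !normrZ !ger0_norm //.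
  have := ler_wpM2r (normr_ge0 v) at'; have := ler_wpM2r (normr_ge0 w) st.
  have : 0 <= t * `|w| by rewrite mulr_ge0 // ltW.
  by rewrite /c; move: (`|v|) (`|w|) => nv nw; nra.
have inD s a : 0 <= s <= t -> 0 <= a <= t -> D (x + a *: v + s *: w).
  by move=> hs ha; rewrite -addrA; have [] := hr _ (small s a hs ha).
have t00 : 0 <= t <= t by apply/andP; split; [exact: ltW | exact: lexx].
have z00 : 0 <= (0 : R) <= t by apply/andP; split; [exact: lexx | exact: ltW].
have df1 s : 0 <= s <= t -> differentiable f (x + t *: v + s *: w).
  by move=> hs; apply: fD; exact: inD.
have df2 s : 0 <= s <= t -> differentiable f (x + s *: w).
  by move=> hs; apply: fD; have := inD s 0 hs z00; rewrite scale0r addr0.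
pose phi s := f (x + t *: v + s *: w) - f (x + s *: w).
have dphi s : 0 <= s <= t ->
    is_derive s 1 phi (h (x + t *: v + s *: w) - h (x + s *: w)).
  move=> hs; have i1 := is_derive_line (df1 s hs); have i2 := is_derive_line (df2 s hs).
  exact: is_deriveB.
have itvP s : s \in `]0, t[ -> 0 <= s <= t.
  by rewrite in_itv /= => /andP[? ?]; rewrite !ltW.
have [s /itvP hs phiE] : exists2 s, s \in `]0, t[ & phi t - phi 0 =
    (h (x + t *: v + s *: w) - h (x + s *: w)) * (t - 0).
  apply: (MVT (f := phi) (df := fun s => h (x + t *: v + s *: w) - h (x + s *: w))) => //.
    by move=> s /itvP; exact: dphi.
  apply: derivable_within_continuous => s; rewrite in_itv /= => hs.
  by have [] := dphi s hs.
have -> : f (x + t *: v + t *: w) - f (x + t *: v) - (f (x + t *: w) - f x) =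
    phi t - phi 0.
  by rewrite /phi !scale0r !addr0; ring.
rewrite phiE subr0.
have xu u : x + u - x = u by rewrite addrC addKr.
have [_] := hr _ (small s t hs t00); have [_] := hr _ (small s 0 hs z00).
have lin a u : 'd h x (a *: u) = a * 'd h x u by exact: linearZ.
rewrite scale0r add0r !xu addrA linearD !lin.
have {hs} /andP[s0 st] := hs.
have := ler_normD (t *: v) (s *: w); rewrite !normrZ (gtr0_norm t0) (ger0_norm s0).
move: (h (x + s *: w)) (h (x + t *: v + s *: w)) (h x) ('d h x v) ('d h x w).
move=> H1 H2 H0 A B; set nvw := `|t *: v + s *: w| => tri k1 k2.
have ec0 : 0 <= e / c by rewrite ltW // divr_gt0.
have -> : (H2 - H1) * t - t ^+ 2 * A =
    t * ((H2 - H0 - (t * A + s * B)) - (H1 - H0 - s * B)) by ring.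
rewrite normrM (gtr0_norm t0) [e * _]mulrC -mulrA ler_pM2l //.
apply: (le_trans (ler_normB _ _)); apply: (le_trans (lerD k2 k1)).
rewrite -mulrDr -[leRHS](_ : e / c * (t * c) = _); last by field; rewrite gt_eqF.
rewrite ler_wpM2l //; apply: (le_trans (lerD tri (lexx _))); rewrite /c.
have := ler_wpM2r (normr_ge0 w) st.
by move: (`|v|) (`|w|) => nv nw; lra.
Qed.

Lemma second_diff_sym (D : set V) f x v w : open D -> D x ->
  contdiff 2 D f ->
  'd (fun y => 'd f y w) x v = 'd (fun y => 'd f y v) x w.
Proof.
move=> oD Dx [fD f2].
have dh u : differentiable (fun y => 'd f y u) x by have [h _] := f2 u; exact: h.
apply/eqP; rewrite -subr_eq0 -normr_le0; apply/ler_addgt0Pr => e e0.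
have e2 : 0 < e / 2 by rewrite divr_gt0.
have [r1 r10 h1] := second_difference v oD Dx fD (dh w) e2.
have [r2 r20 h2] := second_difference w oD Dx fD (dh v) e2.
pose t := Num.min r1 r2 / 2.
have m0 : 0 < Num.min r1 r2 by rewrite lt_min r10.
have t0 : 0 < t by rewrite divr_gt0.
have tm : t < Num.min r1 r2 by rewrite ltr_pdivrMr // mulr2n mulrDr mulr1 ltrDl.
have [t1 t2] : t < r1 /\ t < r2 by apply/andP; move: tm; rewrite lt_min.
have := h1 t t0 t1; have := h2 t t0 t2.
have -> : x + t *: w + t *: v = x + t *: v + t *: w by rewrite addrAC.
move: ('d (fun y => 'd f y w) x v) ('d (fun y => 'd f y v) x w) => A B.
move: (f (x + t *: v + t *: w)) (f (x + t *: v)) (f (x + t *: w)) (f x).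
move=> F1 F2 F3 F4 k1 k2; rewrite add0r.
have tt0 : 0 < t ^+ 2 by rewrite exprn_gt0.
rewrite -(ler_pM2l tt0) -[t ^+ 2 in leLHS]gtr0_norm // -normrM.
have -> : t ^+ 2 * (A - B) = (F1 - F3 - (F2 - F4) - t ^+ 2 * B) -
    (F1 - F2 - (F3 - F4) - t ^+ 2 * A) by ring.
apply: (le_trans (ler_normB _ _)); apply: (le_trans (lerD k1 k2)).
by lra.
Qed.

End SecondDerivative.

(** * Differentiability of spectral functions *)

Section HermiteInterpolation.
Variable R : fieldType.

(** Adjoining a node x to the nodes s corrects an interpolant by a multiple of
    prod (X - a)^2, which changes neither values nor derivatives on s. *)
Lemma hermite_interpolation (s : seq R) (y dy : R -> R) : uniq s ->
  exists p : {poly R}, forall x, x \in s -> p.[x] = y x /\ p^`().[x] = dy x.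
Proof.
elim: s => [_|x s IH /= /andP[xs us]]; first by exists 0.
have [p pP] := IH us; pose v := \prod_(a <- s) ('X - a%:P); pose w := v * v.
have wx : w.[x] != 0.
  by rewrite hornerM mulf_eq0 orbb -/(root _ x) root_prod_XsubC.
have w0 a : a \in s -> w.[a] = 0 /\ w^`().[a] = 0.
  move=> as_; have v0 : v.[a] = 0 by apply/rootP; rewrite root_prod_XsubC.
  by rewrite /w derivM !hornerE v0 !(mul0r, mulr0, addr0).
clearbody w; pose c := (y x - p.[x]) / w.[x].
pose e := (dy x - p^`().[x] - c * w^`().[x]) / w.[x].
exists (p + (c%:P + e%:P * ('X - x%:P)) * w) => a.
have dE b : (p + (c%:P + e%:P * ('X - x%:P)) * w)^`().[b] =
    p^`().[b] + (e * w.[b] + (c + e * (b - x)) * w^`().[b]).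
  by rewrite derivD derivM derivD derivM !derivC derivB derivX derivC !hornerE /=; ring.
rewrite dE hornerD hornerM hornerD hornerM !hornerC hornerXsubC inE => /orP[/eqP ->|as_].
  rewrite subrr mulr0 addr0; split; first by rewrite /c; field.
  by clearbody c; rewrite /e; field.
by have [-> ->] := w0 a as_; rewrite !mulr0 !addr0; exact: pP.
Qed.

End HermiteInterpolation.

Section SpectralFunctions.
Variables (R : realType) (n : nat).
Implicit Types (A B X Y P S E : Sym R n) (h r : R -> R) (p : {poly R}).

Lemma spectral_mx_sym (Q : 'M[R]_n) (d : 'rV[R]_n) :
  Q *m diag_mx d *m Q^T \in @symm_mx R n.
Proof.
by rewrite unfold_in /symm_mx; apply/eqP; rewrite !trmx_mul trmxK tr_diag_mx mulmxA.
Qed.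

(** W has a nonzero entry only between equal eigenvalues, so any function of
    the eigenvalues is intertwined as well. *)
Lemma diag_intertwine h (W : 'M[R]_n) (a b : 'rV[R]_n) :
  diag_mx a *m W = W *m diag_mx b ->
  diag_mx (map_mx h a) *m W = W *m diag_mx (map_mx h b).
Proof.
move=> aW; apply/matrixP => i j; rewrite mul_diag_mx mul_mx_diag !mxE.
move/matrixP: aW => /(_ i j); rewrite mul_diag_mx mul_mx_diag [LHS]mxE [RHS]mxE.
have [->|Wij] := eqVneq (W i j) 0; first by rewrite !mul0r !mulr0.
by rewrite mulrC => /(mulfI Wij) ->; rewrite mulrC.
Qed.

Lemma spectral_mx_uniq h (U V : 'M[R]_n) (a b : 'rV[R]_n) :
  U^T *m U = 1%:M -> V^T *m V = 1%:M ->
  U *m diag_mx a *m U^T = V *m diag_mx b *m V^T ->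
  U *m diag_mx (map_mx h a) *m U^T = V *m diag_mx (map_mx h b) *m V^T.
Proof.
move=> UU VV UV; pose W := U^T *m V.
have aW : diag_mx a *m W = W *m diag_mx b.
  have := congr1 (fun M => U^T *m M *m V) UV.
  by rewrite !mulmxA UU mul1mx -!mulmxA VV mulmx1 !mulmxA.
have UW : U *m W = V by rewrite mulmxA (mulmx1C UU) mul1mx.
have WV : U^T = W *m V^T by rewrite /W -mulmxA (mulmx1C VV) mulmx1.
rewrite [in LHS]WV mulmxA -[_ *m diag_mx _ *m W]mulmxA (diag_intertwine h aW).
by rewrite mulmxA UW.
Qed.

Lemma spectral_funE h A (Q : 'M[R]_n) (d : 'rV[R]_n) :
  Q^T *m Q = 1%:M -> symval A = Q *m diag_mx d *m Q^T ->
  symval (spectral_fun h A) = Q *m diag_mx (map_mx h d) *m Q^T.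
Proof.
move=> QQ AE; rewrite /spectral_fun.
set D := [set B | _].
have ex : exists B, D B.
  by exists (MkSym (spectral_mx_sym Q (map_mx h d))), Q, d.
have [U [a [UU AE' ->]]] := xgetPex 0 ex.
by apply: spectral_mx_uniq => //; rewrite -AE' -AE.
Qed.

Lemma spectral_fun_mulX p c A :
  symval (spectral_fun (horner (p * 'X + c%:P)) A) =
    symval (spectral_fun (horner p) A) *m symval A + c%:M.
Proof.
have [Q [d [QQ AE]]] := spectral_sym A.
rewrite !(spectral_funE _ QQ AE) AE !mulmxA -[_ *m Q^T *m Q]mulmxA QQ mulmx1.
rewrite -[_ *m diag_mx _ *m diag_mx _]mulmxA mulmx_diag.
have -> : c%:M = Q *m diag_mx (const_mx c) *m Q^T.
  by rewrite diag_const_mx mul_mx_scalar -scalemxAl (mulmx1C QQ) scalemx1.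
rewrite -mulmxDl -mulmxDr -raddfD; congr (_ *m diag_mx _ *m _).
by apply/rowP => i; rewrite !mxE !hornerE.
Qed.

Lemma spectral_poly_differentiable p A i j :
  differentiable (fun B => symval (spectral_fun (horner p) B) i j) A.
Proof.
elim/poly_ind: p i j => [|p c IH] i j.
  have -> : (fun B => symval (spectral_fun (horner 0) B) i j) = cst 0.
    apply/funext => B; have [Q [d [QQ BE]]] := spectral_sym B.
    rewrite (spectral_funE _ QQ BE) (_ : map_mx _ d = 0) ?linear0 ?mulmx0 ?mul0mx ?mxE //.
    by apply/rowP => k; rewrite !mxE horner0.
  exact: differentiable_cst.
have -> : (fun B => symval (spectral_fun (horner (p * 'X + c%:P)) B) i j) =
    (fun B => \sum_k symval (spectral_fun (horner p) B) i k * sym_entry k j B) +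
    cst ((c%:M : 'M[R]_n) i j).
  by apply/funext => B; rewrite spectral_fun_mulX [LHS]mxE [X in X + _]mxE.
apply: differentiableD; last exact: differentiable_cst.
apply: is_diff_ex; apply: is_diff_bigsum => k _.
apply: is_diff_mul; first exact: differentiableP (IH i k).
exact: is_diff_continuous_linear (@sym_entry_continuous R n k j).
Qed.

Lemma ortho_entry_le (V : 'M[R]_n) i j : V^T *m V = 1%:M -> `|V i j| <= 1.
Proof.
move=> VV; have /matrixP/(_ j j) := VV.
rewrite !mxE eqxx mulr1n (bigD1 i) //= mxE => e.
have : V i j * V i j <= 1.
  by rewrite -e lerDl sumr_ge0 // => k _; rewrite mxE -expr2 sqr_ge0.
by rewrite -expr2 -real_normK ?num_real // expr_le1.
Qed.

(** For a unit eigenvector v of B, the residual (B - A) v has coordinates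
    (b_j - a_k) <u_k, v> in the eigenbasis of A, and they cannot all be small
    unless some b_j - a_k is. *)
Lemma eigenvalue_perturbation A B (U V : 'M[R]_n) (a b : 'rV[R]_n) j :
  U^T *m U = 1%:M -> V^T *m V = 1%:M ->
  symval A = U *m diag_mx a *m U^T -> symval B = V *m diag_mx b *m V^T ->
  exists k, `|b 0 j - a 0 k| <= n%:R ^+ 3 * `|B - A|.
Proof.
move=> UU VV AE BE; pose W := U^T *m V.
have WE k : (U^T *m symval (B - A) *m V) k j = (b 0 j - a 0 k) * W k j.
  have -> : U^T *m symval (B - A) *m V = W *m diag_mx b - diag_mx a *m W.
    rewrite symvalD symvalN mulmxBr mulmxBl AE BE /W !mulmxA UU mul1mx.
    by congr (_ - _); rewrite -!mulmxA VV mulmx1.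
  by rewrite mul_mx_diag mul_diag_mx !mxE; ring.
have WW : W^T *m W = 1%:M.
  by rewrite /W trmx_mul trmxK mulmxA -[_ *m U *m U^T]mulmxA (mulmx1C UU) mulmx1.
have W1 : \sum_k W k j ^+ 2 = 1.
  have /matrixP/(_ j j) := WW; rewrite !mxE eqxx mulr1n => <-.
  by apply: eq_bigr => k _; rewrite [W^T _ _]mxE.
have bound k : `|(U^T *m symval (B - A) *m V) k j| <= n%:R ^+ 2 * `|B - A|.
  rewrite mxE; apply: (le_trans (ler_norm_sum _ _ _)).
  have -> : n%:R ^+ 2 * `|B - A| = \sum_(l < n) n%:R * `|B - A|.
    by rewrite sumr_const card_ord -[RHS]mulr_natl; ring.
  apply: ler_sum => l _; rewrite normrM -[leRHS]mulr1.
  apply: ler_pM => //; last exact: ortho_entry_le.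
  rewrite mxE; apply: (le_trans (ler_norm_sum _ _ _)).
  have -> : n%:R * `|B - A| = \sum_(m < n) `|B - A|.
    by rewrite sumr_const card_ord -[RHS]mulr_natl.
  apply: ler_sum => m _; rewrite normrM -[leRHS]mul1r.
  apply: ler_pM => //; last exact: sym_entry_le.
  by rewrite mxE; apply: ortho_entry_le.
pose k := [arg min_(k < j) `|b 0 j - a 0 k|]%O.
have kmin l : `|b 0 j - a 0 k| <= `|b 0 j - a 0 l|.
  by rewrite /k; case: arg_minP => // m _; apply.
(* The nearest a_k will do, since the |W_lj| sum to at least 1. *)
exists k; have absW : 1 <= \sum_l `|W l j|.
  rewrite -W1; apply: ler_sum => l _.
  rewrite -real_normK ?num_real // expr2 ler_piMr //.
  exact: ortho_entry_le.
apply: (le_trans (ler_peMr (normr_ge0 _) absW)); rewrite mulr_sumr.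
have -> : n%:R ^+ 3 * `|B - A| = \sum_(l < n) n%:R ^+ 2 * `|B - A|.
  by rewrite sumr_const card_ord -[RHS]mulr_natl; ring.
apply: ler_sum => l _; apply: le_trans (bound l); rewrite WE normrM.
by rewrite ler_wpM2r.
Qed.

(** Subtracting the Hermite interpolant of h at the eigenvalues of A reduces to
    a function r with r(x) = o(x - a_k) at each of them; then r(B) = o(B - A),
    since the eigenvalues of B are within O(|B - A|) of those of A. *)
Lemma spectral_fun_differentiable h A (Q : 'M[R]_n) (d : 'rV[R]_n) :
  Q^T *m Q = 1%:M -> symval A = Q *m diag_mx d *m Q^T ->
  (forall i, derivable h (d 0 i) 1) -> differentiable (@spectral_fun R n h) A.
Proof.
move=> QQ AE hd.
pose s := undup [seq d 0 i | i <- enum 'I_n].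
have ds i : d 0 i \in s by rewrite mem_undup map_f // mem_enum.
have [p pP] := hermite_interpolation h (derive1 h)
  (undup_uniq [seq d 0 i | i <- enum 'I_n]).
pose r x := h x - p.[x].
have rd i : differentiable r (d 0 i).
  apply/derivable1_diffP; apply: derivableB; first exact: hd.
  exact: derivable_horner.
have r0 i : r (d 0 i) = 0 by rewrite /r; have [-> _] := pP _ (ds i); rewrite subrr.
have dr0 i x : 'd r (d 0 i) x = 0.
  have -> : 'd r (d 0 i) x = x * 'd r (d 0 i) 1.
    by rewrite -[X in 'd r _ X](mulr1 x); exact: linearZ.
  rewrite -deriveE // /r deriveB; [|exact: hd|exact: derivable_horner].
  by rewrite -!derive1E -derivE; have [_ ->] := pP _ (ds i); rewrite subrr mulr0.
have small e : 0 < e -> exists2 r1 : R, 0 < r1 &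
    forall i x, `|x - d 0 i| < r1 -> `|r x| <= e * `|x - d 0 i|.
  move=> e0.
  have : \forall r1 \near 0^'+,
      forall i x, `|x - d 0 i| < r1 -> `|r x| <= e * `|x - d 0 i|.
    apply: filter_forall => i.
    have /nbhs_normP [r1 r10 r1P] := diff_eps (rd i) e0.
    near=> r2 => x xr; have /= := r1P x.
    rewrite distrC r0 subr0 dr0 subr0; apply; apply: (lt_le_trans xr).
    by near: r2; exact: nbhs_right_le.
  move=> H; near (0 : R)^'+ => r1; exists r1 => //.
  by near: r1.
have Rd i j : is_diff A (fun B => symval (spectral_fun r B) i j) (fun _ => 0).
  apply: (is_diff_of_eps (df := \0)); first exact: cst_continuous.
  move=> e e0.
  (* A factor n^3 comes from the eigenvalues, another n from the sum giving an
     entry. *)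
  pose C : R := n%:R ^+ 4 + 1; have C0 : 0 < C by rewrite ltr_wpDl ?exprn_ge0.
  have [r1 r10 r1P] := small _ (divr_gt0 e0 C0).
  have r2 : 0 < r1 / (n%:R ^+ 3 + 1) by rewrite divr_gt0 // ltr_wpDl ?exprn_ge0.
  apply: filterS (near_dist A r2) => B.
  rewrite ltr_pdivlMr ?ltr_wpDl ?exprn_ge0 // => BA.
  have [V [b [VV BE]]] := spectral_sym B.
  have rb l : `|r (b 0 l)| <= e / C * (n%:R ^+ 3 * `|B - A|).
    have [k bk] := eigenvalue_perturbation l QQ VV AE BE.
    apply: (le_trans (r1P k _ _)).
      apply: (le_lt_trans bk); apply: le_lt_trans BA.
      by rewrite mulrC ler_wpM2l // lerDl.
    by rewrite ler_wpM2l // ltW // divr_gt0.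
  rewrite (spectral_funE r QQ AE) (_ : map_mx r d = 0); last first.
    by apply/rowP => k; rewrite !mxE r0.
  rewrite linear0 mulmx0 mul0mx mxE !subr0 (spectral_funE r VV BE).
  rewrite mxE; apply: (le_trans (ler_norm_sum _ _ _)).
  apply: (@le_trans _ _ (\sum_(l < n) e / C * (n%:R ^+ 3 * `|B - A|))).
    apply: ler_sum => l _; rewrite mul_mx_diag !mxE !normrM.
    rewrite -[leRHS]mulr1; apply: ler_pM => //; last exact: ortho_entry_le.
    rewrite -[leRHS]mul1r; apply: ler_pM => //.
    exact: ortho_entry_le.
  rewrite sumr_const card_ord -[leLHS]mulr_natl.
  have -> : n%:R * (e / C * (n%:R ^+ 3 * `|B - A|)) =
    e * (n%:R ^+ 4 / C) * `|B - A| by ring.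
  rewrite ler_wpM2r // ler_piMr ?ltW //.
  by rewrite ltr_pdivrMr // mul1r /C ltrDl.
have Q1 : (1%:M : 'M[R]_n)^T *m 1%:M = 1%:M by rewrite trmx1 mulmx1.
have hij i j : differentiable (fun B => symval (spectral_fun h B) i j) A.
  have -> : (fun B => symval (spectral_fun h B) i j) =
     (fun B => symval (spectral_fun (horner p) B) i j) +
     (fun B => symval (spectral_fun r B) i j).
    apply/funext => B; have [V [b [VV BE]]] := spectral_sym B.
    have -> : symval (spectral_fun h B) = symval (spectral_fun (horner p) B) +
        symval (spectral_fun r B).
      rewrite !(spectral_funE _ VV BE) -mulmxDl -mulmxDr -raddfD.
      congr (_ *m diag_mx _ *m _).
      by apply/rowP => k; rewrite !mxE /r addrC subrK.
    exact: mxE.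
  apply: differentiableD; first exact: spectral_poly_differentiable.
  exact: is_diff_ex (Rd i j).
exact: (differentiable_entries Q1 hij).
Unshelve. all: by end_near. Qed.

End SpectralFunctions.

(** * The operator Dexp(log P) o Dlog(P^2) *)

Section ProcrustesOperator.
Variables (R : realType) (n : nat).
Implicit Types (A B H X Y Z P S E : Sym R n).

Lemma sexp_differentiable A : differentiable (@sexp R n) A.
Proof.
have [Q [d [QQ AE]]] := spectral_sym A.
by apply: (spectral_fun_differentiable QQ AE) => i; exact: derivable_expR.
Qed.

Lemma slog_differentiable A : spd A -> differentiable (@slog R n) A.
Proof.
move=> sA; have [Q [d [QQ AE]]] := spectral_sym A.
apply: (spectral_fun_differentiable QQ AE) => i.
by have [] := is_derive1_ln (spd_eig_gt0 sA QQ AE i).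
Qed.

Lemma spectral_mx_mul (Q : 'M[R]_n) (d e : 'rV[R]_n) : Q^T *m Q = 1%:M ->
  (Q *m diag_mx d *m Q^T) *m (Q *m diag_mx e *m Q^T) =
  Q *m diag_mx (\row_i (d 0 i * e 0 i)) *m Q^T.
Proof.
move=> QQ; rewrite !mulmxA -[_ *m Q^T *m Q]mulmxA QQ mulmx1.
by rewrite -[_ *m diag_mx d *m diag_mx e]mulmxA mulmx_diag.
Qed.

Lemma spow2E P : spd P -> symval (spow P (2 * 1)) = symval P *m symval P.
Proof.
move=> sP; have [Q [d [QQ PE]]] := spectral_sym P.
have d0 := spd_eig_gt0 sP QQ PE.
rewrite (spectral_funE _ QQ PE) PE spectral_mx_mul //.
congr (_ *m diag_mx _ *m _); apply/rowP => i; rewrite !mxE mulr1.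
by rewrite powR_mulrn ?ltW // expr2.
Qed.

Lemma spow2_spd P : spd P -> spd (spow P (2 * 1)).
Proof.
move=> sP; have [Q [d [QQ PE]]] := spectral_sym P.
have d0 := spd_eig_gt0 sP QQ PE.
apply: (spd_of_eig QQ (spectral_funE _ QQ PE)) => i.
by rewrite mxE powR_gt0.
Qed.

(** The square root of B, written with the maps whose derivatives enter the
    Procrustes metric. *)
Definition log_sqrt B : Sym R n := sexp (2^-1 *: slog B).

Lemma half_slogE B (Q : 'M[R]_n) (d : 'rV[R]_n) :
  Q^T *m Q = 1%:M -> symval B = Q *m diag_mx d *m Q^T ->
  symval (2^-1 *: slog B) = Q *m diag_mx (map_mx (fun x => 2^-1 * ln x) d) *m Q^T.
Proof.
move=> QQ BE; rewrite symvalZ (spectral_funE _ QQ BE) scalemxAl scalemxAr.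
rewrite -linearZ /=; congr (_ *m diag_mx _ *m _).
by apply/rowP => i; rewrite !mxE.
Qed.

Lemma log_sqrt_sqr B : spd B ->
  symval (log_sqrt B) *m symval (log_sqrt B) = symval B.
Proof.
move=> sB; have [Q [d [QQ BE]]] := spectral_sym B.
have d0 := spd_eig_gt0 sB QQ BE.
rewrite (spectral_funE _ QQ (half_slogE QQ BE)) spectral_mx_mul // [RHS]BE.
congr (_ *m diag_mx _ *m _); apply/rowP => i; rewrite !mxE -expRD -mulrDl.
by rewrite -[X in X + X]div1r -splitr mul1r lnK // posrE.
Qed.

Lemma half_slog_spow2 P : spd P -> 2^-1 *: slog (spow P (2 * 1)) = slog P.
Proof.
move=> sP; have [Q [d [QQ PE]]] := spectral_sym P.
have d0 := spd_eig_gt0 sP QQ PE; apply: sym_inj.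
rewrite (half_slogE QQ (spectral_funE _ QQ PE)) (spectral_funE _ QQ PE).
congr (_ *m diag_mx _ *m _); apply/rowP => i; rewrite !mxE mulr1.
by rewrite powR_mulrn ?ltW // lnXn // -(mulr_natl (ln _)) mulKf.
Qed.

Lemma sexp_slog P : spd P -> sexp (slog P) = P.
Proof.
move=> sP; have [Q [d [QQ PE]]] := spectral_sym P.
have d0 := spd_eig_gt0 sP QQ PE; apply: sym_inj.
rewrite (spectral_funE _ QQ (spectral_funE _ QQ PE)) [RHS]PE.
congr (_ *m diag_mx _ *m _); apply/rowP => i; rewrite !mxE lnK //.
by rewrite posrE.
Qed.

(** Differentiating log_sqrt(B)^2 = B at B = P^2 shows that
    Dexp(log P) o Dlog(P^2) is twice the inverse of the operator
    Z |-> ZP + PZ. *)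
Lemma dexp_dlog_anticomm P E : spd P ->
  anticomm ('d (@sexp R n) (slog P) ('d (@slog R n) (spow P (2 * 1)) E)) P
  = 2 *: E.
Proof.
move=> sP; set A := spow P (2 * 1); have sA : spd A by exact: spow2_spd.
have rA : log_sqrt A = P by rewrite /log_sqrt half_slog_spow2 // sexp_slog.
pose T E := 'd (@sexp R n) (slog P) (2^-1 *: 'd (@slog R n) A E).
have dhalf : is_diff A (fun B => 2^-1 *: slog B) (fun E => 2^-1 *: 'd (@slog R n) A E).
  exact: (is_diffZ 2^-1 (differentiableP (slog_differentiable sA))).
have droot : is_diff A log_sqrt T.
  have h : is_diff (2^-1 *: slog A) (@sexp R n) ('d (@sexp R n) (slog P)).
    rewrite half_slog_spow2 //; apply: differentiableP.
    exact: sexp_differentiable.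
  exact: (@is_diff_comp _ _ _ _ _ _ _ _ _ dhalf h).
have TE i j : (symval (T E) *m symval P + symval P *m symval (T E)) i j =
    symval E i j.
  have ent k l : is_diff A (fun B => symval (log_sqrt B) k l)
                           (fun E => symval (T E) k l).
    have h := is_diff_continuous_linear (log_sqrt A) (@sym_entry_continuous R n k l).
    exact: (@is_diff_comp _ _ _ _ log_sqrt T (sym_entry k l) (sym_entry k l) A droot h).
  have hprod := is_diff_mulmx ent ent i j.
  have near_sq : \forall B \near A,
      (symval (log_sqrt B) *m symval (log_sqrt B)) i j = sym_entry i j B.
    by apply: filterS (nearD (@open_spd R n) sA) => B sB; rewrite log_sqrt_sqr.
  have [_ h1] := near_eq_is_diff near_sq (is_diff_ex hprod).
  have h2 := is_diff_val E hprod.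
  have h3 := is_diff_val E (is_diff_continuous_linear A (@sym_entry_continuous R n i j)).
  rewrite /= rA in h2; rewrite -h2.
  exact: (etrans (esym (congr1 (@^~ E) h1)) h3).
have T2 : 'd (@sexp R n) (slog P) ('d (@slog R n) A E) = 2 *: T E.
  by rewrite /T [X in _ *: X]linearZ scalerA mulfV // scale1r.
rewrite T2; apply: sym_inj; apply/matrixP => i j.
rewrite [LHS]/= -scalemxAl -scalemxAr -scalerDr [LHS]mxE TE.
by rewrite symvalZ mxE.
Qed.

End ProcrustesOperator.

(** * The Procrustes and affine-invariant metrics in an eigenbasis *)

Section Metrics.
Variables (R : realType) (n : nat).
Implicit Types (A B H X Y Z P S E : Sym R n) (g : metric R n).

Lemma frob_inj X Y : (forall Z, frob X Z = frob Y Z) -> X = Y.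
Proof.
move=> XY; apply/eqP; rewrite -subr_eq0; apply/negPn/negP => /frob_gt0.
by rewrite {1}linearB /= !(frobC (X - Y)) XY subrr ltxx.
Qed.

Lemma diagonal_metric_expansion g P (Q : 'M[R]_n) (gamma : basis_idx n -> R) X Y :
  Q^T *m Q = 1%:M ->
  (forall a X Y Z, g P (a *: X + Y) Z = a * g P X Z + g P Y Z) ->
  (forall k Z, g P (sym_basis Q k) Z = gamma k * frob (sym_basis Q k) Z) ->
  g P X Y =
    \sum_k gamma k * (frob (sym_basis Q k) X * frob (sym_basis Q k) Y).
Proof.
move=> QQ lin diag.
pose G := g P ^~ Y; have Glin : linear G by move=> a U V; exact: lin.
pose L : {linear Sym R n -> R} := HB.pack G (GRing.isLinear.Build _ _ _ _ _ Glin).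
rewrite -[LHS]/(L X) [in LHS](basis_expansion QQ X) linear_sum.
apply: eq_bigr => k _; rewrite linearZ /= /G diag.
by rewrite -[LHS]/(_ * _); ring.
Qed.

(** Symmetry and positivity are read off the diagonal form of the metric in a
    basis that may depend on the base point. *)
Lemma riemannian_of_diagonal g :
  (forall P, spd P -> forall a X Y Z,
    g P (a *: X + Y) Z = a * g P X Z + g P Y Z) ->
  (forall P, spd P -> exists (Q : 'M[R]_n) (gamma : basis_idx n -> R),
    [/\ Q^T *m Q = 1%:M, forall k, 0 < gamma k
      & forall k Z, g P (sym_basis Q k) Z = gamma k * frob (sym_basis Q k) Z]) ->
  (forall X Y, contdiff 1 (@spd R n) (fun P => g P X Y)) -> riemannian g.
Proof.
move=> lin diag C1; split => // P sP; have [Q [gamma [QQ gamma0 gQ]]] := diag P sP.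
  move=> X Y; rewrite !(diagonal_metric_expansion _ _ QQ (lin P sP) gQ).
  by apply: eq_bigr => k _; rewrite [_ * frob _ Y]mulrC.
move=> X X0; rewrite (diagonal_metric_expansion _ _ QQ (lin P sP) gQ).
have [k Xk] : exists k, frob (sym_basis Q k) X != 0.
  apply/existsP; apply: contraNT X0; rewrite negb_exists => /forallP h.
  rewrite (basis_expansion QQ X) big1 // => k _.
  by move: (h k); rewrite negbK => /eqP ->; rewrite scale0r.
rewrite (bigD1 k) //= ltr_pwDl //.
  by rewrite mulr_gt0 // -expr2 exprn_even_gt0.
by apply: sumr_ge0 => l _; rewrite mulr_ge0 ?(ltW (gamma0 l)) // -expr2 sqr_ge0.
Qed.

Lemma basis_mx_conj (Q : 'M[R]_n) i j :
  basis_mx Q i j = Q *m basis_mx 1%:M i j *m Q^T.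
Proof.
rewrite /basis_mx trmx1; case: ifP => _; rewrite ?mulmx1 ?mul1mx //.
by rewrite -scalemxAr -scalemxAl.
Qed.

(** The basis matrix of index (i, j) is supported on the positions (i, j) and
    (j, i), where a symmetric function takes the value phi i j. *)
Lemma basis_mx1_supp (phi : 'I_n -> 'I_n -> R) i j a b :
  (forall a b, phi a b = phi b a) ->
  basis_mx 1%:M i j a b * phi a b = phi i j * basis_mx 1%:M i j a b.
Proof.
move=> phiC; have supp k l : (delta_mx k l : 'M[R]_n) a b * phi a b =
    phi k l * (delta_mx k l : 'M[R]_n) a b.
  rewrite mxE; case: (a =P k) => [->|_]; case: (b =P l) => [->|_] /=;
    by rewrite ?mul1r ?mulr1 ?mul0r ?mulr0.
rewrite /basis_mx trmx1 !mulmx1 !mul1mx; case: ifP => [/eqP <-|_]; first exact: supp.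
have -> (c : R) (M N : 'M[R]_n) : (c *: (M + N)) a b = c * (M a b + N a b).
  by rewrite !mxE.
by rewrite -mulrA mulrDl !supp (phiC j i) -mulrDr mulrCA.
Qed.

Section Eigenbasis.
Variables (P : Sym R n) (Q : 'M[R]_n) (d : 'rV[R]_n).
Hypotheses (QQ : Q^T *m Q = 1%:M) (PE : symval P = Q *m diag_mx d *m Q^T).

Lemma conj_diag_l (M : 'M[R]_n) (a : 'rV[R]_n) :
  (Q *m diag_mx a *m Q^T) *m (Q *m M *m Q^T) = Q *m (diag_mx a *m M) *m Q^T.
Proof. by rewrite !mulmxA -[_ *m Q^T *m Q]mulmxA QQ mulmx1. Qed.

Lemma conj_diag_r (M : 'M[R]_n) (a : 'rV[R]_n) :
  (Q *m M *m Q^T) *m (Q *m diag_mx a *m Q^T) = Q *m (M *m diag_mx a) *m Q^T.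
Proof. by rewrite !mulmxA -[_ *m Q^T *m Q]mulmxA QQ mulmx1. Qed.

Lemma anticomm_basis k :
  anticomm (sym_basis Q k) P = (d 0 (val k).1 + d 0 (val k).2) *: sym_basis Q k.
Proof.
apply: sym_inj; rewrite /= PE basis_mx_conj conj_diag_l conj_diag_r.
rewrite -mulmxDl -mulmxDr scalemxAl scalemxAr; congr (_ *m _ *m _).
apply/matrixP => a b; rewrite mul_diag_mx mul_mx_diag !mxE.
rewrite -(basis_mx1_supp (phi := fun a b => d 0 a + d 0 b)); first by ring.
by move=> ? ?; rewrite addrC.
Qed.

Lemma frob_anticomm_basis k X :
  frob (sym_basis Q k) (anticomm X P) =
    (d 0 (val k).1 + d 0 (val k).2) * frob (sym_basis Q k) X.
Proof.
have adj Y Z : frob Y (anticomm Z P) = frob (anticomm Y P) Z.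
  rewrite /frob !sym_tr /= mulmxDl mulmxDr !mxtraceD mulmxA addrC; congr (_ + _).
    by rewrite mulmxA.
  by rewrite mxtrace_mulC -mulmxA.
by rewrite adj anticomm_basis frobC linearZ /= frobC.
Qed.

End Eigenbasis.

Lemma anticommD X Y A : anticomm (X + Y) A = anticomm X A + anticomm Y A.
Proof. by apply: sym_inj; rewrite /= mulmxDl mulmxDr addrACA. Qed.

Lemma anticommZ a X A : anticomm (a *: X) A = a *: anticomm X A.
Proof. by apply: sym_inj; rewrite /= -scalemxAl -scalemxAr -scalerDr. Qed.

Lemma frob_anticomm_linear A a X Y Z :
  frob (anticomm (a *: X + Y) A) Z =
  a * frob (anticomm X A) Z + frob (anticomm Y A) Z.
Proof. by rewrite anticommD anticommZ frobC frob_linear !(frobC Z). Qed.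

Lemma anticomm_inj A X Y : spd A -> anticomm X A = anticomm Y A -> X = Y.
Proof.
move=> sA XY; have [Q [d [QQ AE]]] := spectral_sym A.
have d0 := spd_eig_gt0 sA QQ AE.
rewrite (basis_expansion QQ X) (basis_expansion QQ Y); apply: eq_bigr => k _.
congr (_ *: _); have dd : d 0 (val k).1 + d 0 (val k).2 != 0.
  by rewrite gt_eqF // addr_gt0.
by apply: (mulfI dd); rewrite -!(frob_anticomm_basis QQ AE) XY.
Qed.

Lemma entry_C1 i j : contdiff 1 (@spd R n) (fun P => symval P i j).
Proof.
have h := contdiff1_linear (@open_spd R n) (@sym_entry_continuous R n i j).
exact: h.
Qed.

Lemma frob_C1 (F G : Sym R n -> Sym R n) :
  (forall i j, contdiff 1 (@spd R n) (fun P => symval (F P) i j)) ->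
  (forall i j, contdiff 1 (@spd R n) (fun P => symval (G P) i j)) ->
  contdiff 1 (@spd R n) (fun P => frob (F P) (G P)).
Proof.
move=> hF hG; apply: (contdiff1_eq (@open_spd R n)
    (F := fun P => \sum_i \sum_j symval (F P) i j * symval (G P) i j)).
  by move=> P _; rewrite frobE.
apply: contdiff1_sum => [|i _]; first exact: open_spd.
apply: contdiff1_sum => [|j _]; first exact: open_spd.
by apply: contdiff1_mul; [exact: open_spd | exact: hF | exact: hG].
Qed.

Lemma anticomm_C1 (A : Sym R n -> Sym R n) X i j :
  (forall i j, contdiff 1 (@spd R n) (fun P => symval (A P) i j)) ->
  contdiff 1 (@spd R n) (fun P => symval (anticomm X (A P)) i j).
Proof.
move=> hA; have cX k l : contdiff 1 (@spd R n) (fun=> symval X k l).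
  exact: (contdiff1_cst (@open_spd R n)).
apply: (contdiff1_eq (@open_spd R n)
    (F := fun P => (symval X *m symval (A P)) i j + (symval (A P) *m symval X) i j)).
  by move=> P _; rewrite /= [RHS]mxE.
apply: contdiff1_add; first exact: open_spd.
  exact: (contdiff1_mulmx (A := fun=> symval X) (B := fun P => symval (A P))
    (@open_spd R n) cX hA i j).
exact: (contdiff1_mulmx (A := fun P => symval (A P)) (B := fun=> symval X)
  (@open_spd R n) hA cX i j).
Qed.

Lemma spow2_C1 i j : contdiff 1 (@spd R n) (fun P => symval (spow P (2 * 1)) i j).
Proof.
apply: (contdiff1_eq (@open_spd R n) (F := fun P => (symval P *m symval P) i j)).
  by move=> P sP; rewrite spow2E.
exact: (contdiff1_mulmx (A := fun P => symval P) (B := fun P => symval P)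
  (@open_spd R n) entry_C1 entry_C1 i j).
Qed.

Lemma spow2_eig P (Q : 'M[R]_n) (d : 'rV[R]_n) : spd P ->
  Q^T *m Q = 1%:M -> symval P = Q *m diag_mx d *m Q^T ->
  symval (spow P (2 * 1)) = Q *m diag_mx (\row_i d 0 i ^+ 2) *m Q^T.
Proof.
by move=> sP QQ PE; rewrite spow2E // PE spectral_mx_mul.
Qed.

(** Pairing X with the Lyapunov operator H |-> H P^2 + P^2 H gives itself a
    Riemannian metric; inverting that operator is finding representers for it,
    which yields its C^1 dependence on P. *)
Definition lyapunov_metric : metric R n :=
  fun P X Y => frob (anticomm X (spow P (2 * 1))) Y.

Lemma lyapunov_riemannian : riemannian lyapunov_metric.
Proof.
apply: riemannian_of_diagonal.
- by move=> P _ a X Y Z; exact: frob_anticomm_linear.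
- move=> P sP; have [Q [d [QQ PE]]] := spectral_sym (spow P (2 * 1)).
  have d0 := spd_eig_gt0 (spow2_spd sP) QQ PE.
  exists Q, (fun k => d 0 (val k).1 + d 0 (val k).2); split => //.
    by move=> k; rewrite addr_gt0.
  by move=> k Z; rewrite /lyapunov_metric (anticomm_basis QQ PE) frobC linearZ /= frobC.
- move=> X Y; apply: (frob_C1 (G := fun=> Y)) => i j.
    by apply: anticomm_C1; exact: spow2_C1.
  exact: (contdiff1_cst (@open_spd R n)).
Qed.

(** By dexp_dlog_anticomm the equation defining H amounts to the Lyapunov
    equation 2 (H P^2 + P^2 H) = Y P + P Y. *)
Lemma procrustes_opE P Y : spd P -> procrustes_op 1 P Y =
  representer lyapunov_metric P (frob (2^-1 *: anticomm Y P)).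
Proof.
move=> sP; set H0 := representer _ _ _.
have sA := spow2_spd sP.
have H0E : anticomm H0 (spow P (2 * 1)) = 2^-1 *: anticomm Y P.
  apply: frob_inj => Z.
  have := representerP lyapunov_riemannian Z sP
    (frob_is_linear (2^-1 *: anticomm Y P)).
  by rewrite -/H0.
rewrite /procrustes_op; set D := [set H | _].
have ex : exists H, D H.
  exists H0; apply: (anticomm_inj sP); rewrite dexp_dlog_anticomm // H0E.
  by rewrite scalerA divff // scale1r.
have := xgetPex 0 ex; set H := xget _ _; rewrite /D /= => HP.
apply: (anticomm_inj sA); rewrite H0E.
have := dexp_dlog_anticomm (anticomm H (spow P (2 * 1))) sP; rewrite HP => ->.
by rewrite scalerA mulVf // scale1r.
Qed.

Lemma procrustes_opP P Y : spd P ->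
  anticomm (procrustes_op 1 P Y) (spow P (2 * 1)) = 2^-1 *: anticomm Y P.
Proof.
move=> sP; rewrite procrustes_opE //.
apply: frob_inj => Z.
exact: (representerP lyapunov_riemannian Z sP (frob_is_linear _)).
Qed.

Lemma procrustes_metricE P X Y : spd P ->
  procrustes_metric 1 P X Y = frob (anticomm X P) (procrustes_op 1 P Y).
Proof.
move=> sP; rewrite /procrustes_metric.
set HX := procrustes_op 1 P X; set HY := procrustes_op 1 P Y.
set A := spow P (2 * 1).
have -> : anticomm X P = 2 *: anticomm HX A.
  by rewrite procrustes_opP // scalerA divff // scale1r.
rewrite frobC linearZ /= frobC -[RHS]/(2 * _) /frob sym_tr /= mulmxDl mxtraceD.
have -> : \tr (symval A *m symval HX *m symval HY) =
    \tr (symval HX *m symval A *m symval HY).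
  by rewrite -[LHS]mxtrace_tr !trmx_mul !sym_tr mxtrace_mulC.
by ring.
Qed.

Lemma procrustes_op_C1 Y i j :
  contdiff 1 (@spd R n) (fun P => symval (procrustes_op 1 P Y) i j).
Proof.
have oS := @open_spd R n.
have h : contdiff 1 (@spd R n) (fun P =>
    representer lyapunov_metric P (frob (2^-1 *: anticomm Y P))).
  apply: (representer_C1 lyapunov_riemannian) => Z.
  apply: (frob_C1 (G := fun=> Z)) => k l; last exact: (contdiff1_cst (@open_spd R n)).
  apply: (contdiff1_eq oS (F := fun P => 2^-1 * symval (anticomm Y P) k l)).
    by move=> P _; rewrite symvalZ [RHS]mxE.
  have hY := anticomm_C1 Y k l entry_C1.
  exact: (contdiff1_mul oS (contdiff1_cst oS (2^-1 : R)) hY).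
apply: (contdiff1_eq oS (F := sym_entry i j \o (fun P =>
    representer lyapunov_metric P (frob (2^-1 *: anticomm Y P))))).
  by move=> P sP; rewrite /= procrustes_opE.
by apply: contdiff1_linear_comp => //; exact: sym_entry_continuous.
Qed.

(** On the basis matrix of index (i, j), the maps H |-> H P^2 + P^2 H and
    Y |-> Y P + P Y are multiplication by d_i^2 + d_j^2 and by d_i + d_j. *)
Lemma procrustes_diag P (Q : 'M[R]_n) (d : 'rV[R]_n) k Z : spd P ->
  Q^T *m Q = 1%:M -> symval P = Q *m diag_mx d *m Q^T ->
  procrustes_metric 1 P (sym_basis Q k) Z =
    (d 0 (val k).1 + d 0 (val k).2) ^+ 2 /
    (2 * (d 0 (val k).1 ^+ 2 + d 0 (val k).2 ^+ 2)) * frob (sym_basis Q k) Z.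
Proof.
move=> sP QQ PE; have d0 := spd_eig_gt0 sP QQ PE.
set a := d 0 (val k).1; set b := d 0 (val k).2.
have a0 : 0 < a by exact: d0. have b0 : 0 < b by exact: d0.
have AE := spow2_eig sP QQ PE.
have h : (a ^+ 2 + b ^+ 2) * frob (sym_basis Q k) (procrustes_op 1 P Z) =
    2^-1 * ((a + b) * frob (sym_basis Q k) Z).
  have := frob_anticomm_basis QQ AE k (procrustes_op 1 P Z).
  rewrite !mxE -/a -/b => <-; rewrite procrustes_opP // -(frob_anticomm_basis QQ PE).
  exact: linearZ.
have s0 : a ^+ 2 + b ^+ 2 != 0 by rewrite gt_eqF // addr_gt0 // exprn_gt0.
rewrite procrustes_metricE // (anticomm_basis QQ PE) frobC linearZ /= frobC.
rewrite -[LHS]/((a + b) * _); move: (frob _ _) (frob _ _) h => x y h.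
have -> : y = 2^-1 * ((a + b) * x) / (a ^+ 2 + b ^+ 2).
  by rewrite -h mulrC mulKf.
by field.
Qed.

Lemma procrustes_riemannian : riemannian (@procrustes_metric R n 1).
Proof.
have oS := @open_spd R n.
apply: riemannian_of_diagonal.
- move=> P sP a X Y Z; rewrite !procrustes_metricE //.
  exact: frob_anticomm_linear.
- move=> P sP; have [Q [d [QQ PE]]] := spectral_sym P.
  have d0 := spd_eig_gt0 sP QQ PE.
  exists Q, (fun k => (d 0 (val k).1 + d 0 (val k).2) ^+ 2 /
    (2 * (d 0 (val k).1 ^+ 2 + d 0 (val k).2 ^+ 2))); split => //.
    by move=> k; rewrite divr_gt0 ?exprn_gt0 ?mulr_gt0 ?addr_gt0 ?exprn_gt0.
  by move=> k Z; exact: procrustes_diag.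
- move=> X Y; apply: (contdiff1_eq oS
    (F := fun P => frob (anticomm X P) (procrustes_op 1 P Y))).
    by move=> P sP; rewrite procrustes_metricE.
  apply: frob_C1 => i j; last exact: procrustes_op_C1.
  by apply: anticomm_C1; exact: entry_C1.
Qed.

Lemma invmx_spectral (Q : 'M[R]_n) (d : 'rV[R]_n) : Q^T *m Q = 1%:M ->
  (forall i, d 0 i != 0) ->
  invmx (Q *m diag_mx d *m Q^T) = Q *m diag_mx (map_mx GRing.inv d) *m Q^T.
Proof.
move=> QQ d0; set A := Q *m diag_mx d *m Q^T; set B := _ *m _ *m Q^T.
have AB : A *m B = 1%:M.
  rewrite spectral_mx_mul // (_ : \row_i _ = const_mx 1).
    by rewrite diag_const_mx mulmx1 (mulmx1C QQ).
  by apply/rowP => i; rewrite !mxE divff.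
have [uA _] := mulmx1_unit AB.
by rewrite -[LHS]mulmx1 -AB mulmxA mulVmx // mul1mx.
Qed.

Lemma ai_diag P (Q : 'M[R]_n) (d : 'rV[R]_n) k Z : spd P ->
  Q^T *m Q = 1%:M -> symval P = Q *m diag_mx d *m Q^T ->
  ai_metric P (sym_basis Q k) Z =
    (d 0 (val k).1 * d 0 (val k).2)^-1 * frob (sym_basis Q k) Z.
Proof.
move=> sP QQ PE; have d0 := spd_eig_gt0 sP QQ PE.
rewrite /ai_metric PE invmx_spectral //; last by move=> i; rewrite gt_eqF.
rewrite /frob sym_tr /= !(basis_mx_conj Q) (conj_diag_l QQ) (conj_diag_r QQ).
rewrite -mxtraceZ scalemxAl; congr (\tr (_ *m _)).
rewrite scalemxAl scalemxAr; congr (_ *m _ *m _); apply/matrixP => a b.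
rewrite mul_diag_mx mul_mx_diag [LHS]mxE [X in X * _]mxE [RHS]mxE.
rewrite [map_mx _ _ _ a]mxE [map_mx _ _ _ b]mxE.
rewrite -(basis_mx1_supp (phi := fun a b => (d 0 a * d 0 b)^-1)).
  by rewrite invfM; ring.
by move=> ? ?; rewrite mulrC.
Qed.

Lemma ai_riemannian : riemannian (@ai_metric R n).
Proof.
have oS := @open_spd R n.
apply: riemannian_of_diagonal.
- move=> P sP a X Y Z; rewrite /ai_metric symvalD symvalZ.
  by rewrite mulmxDr -scalemxAr !mulmxDl -!scalemxAl mxtraceD mxtraceZ.
- move=> P sP; have [Q [d [QQ PE]]] := spectral_sym P.
  have d0 := spd_eig_gt0 sP QQ PE.
  exists Q, (fun k => (d 0 (val k).1 * d 0 (val k).2)^-1); split => //.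
    by move=> k; rewrite invr_gt0 mulr_gt0.
  by move=> k Z; exact: ai_diag.
- move=> X Y; have cX k l (W : Sym R n) : contdiff 1 (@spd R n) (fun=> symval W k l).
    exact: (contdiff1_cst (@open_spd R n)).
  have inv_C1 : forall i j, contdiff 1 (@spd R n) (fun P => invmx (symval P) i j).
    by apply: (contdiff1_invmx oS); [exact: entry_C1 | exact: spd_unitmx].
  apply: contdiff1_sum => // i _.
  apply: (contdiff1_mulmx (A := fun P => invmx (symval P) *m symval X *m invmx (symval P))
    (B := fun=> symval Y) oS _ (fun k l => cX k l Y)).
  apply: (contdiff1_mulmx (A := fun P => invmx (symval P) *m symval X)
    (B := fun P => invmx (symval P)) oS _ inv_C1).
  exact: (contdiff1_mulmx (A := fun P => invmx (symval P)) (B := fun=> symval X)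
    oS inv_C1 (fun k l => cX k l X)).
Qed.

End Metrics.

(** * Comparison of the condition numbers *)

Section HessiansAtMinimum.
Variables (R : realType) (n : nat) (f : Sym R n -> R) (P : Sym R n).
Variable Q : 'M[R]_n.
Hypotheses (f_C2 : contdiff 2 (@spd R n) f) (P_min : local_minimizer f P).
Hypotheses (QQ : Q^T *m Q = 1%:M).
Implicit Types (X Y Z : Sym R n).

Let spdP : spd P. Proof. by have [] := P_min. Qed.

Lemma minimizer_critical X : 'd f P X = 0.
Proof.
have [_ fmin] := P_min; apply: local_min_diff0; first by have [h _] := f_C2; exact: h.
apply: filterS2 fmin (nearD (@open_spd R n) spdP) => S; exact.
Qed.

Lemma hessian_form_sym Y Z : hessian_form f P Y Z = hessian_form f P Z Y.
Proof. exact: second_diff_sym (@open_spd R n) spdP f_C2. Qed.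

Local Notation K := (mx_in_basis Q (ehess f P)).

Lemma ehess_mxE k l : K k l = hessian_form f P (ebasis Q l) (ebasis Q k).
Proof. by rewrite mxE frobC ehess_form. Qed.

Lemma ehess_mx_sym : K^T = K.
Proof. by apply/matrixP => k l; rewrite [LHS]mxE !ehess_mxE hessian_form_sym. Qed.

Lemma ehess_mx_pos (u : 'rV[R]_#|basis_idx n|) : nondegenerate_at f P ->
  u != 0 -> 0 < dot (u *m K) u.
Proof.
move=> nondeg u0; pose U := \sum_k u 0 k *: ebasis Q k.
have uE k : frob (ebasis Q k) U = u 0 k by exact: (frob_ebasis_sum QQ).
have U0 : U != 0.
  apply: contra_neq u0 => U0; apply/rowP => k.
  by rewrite -uE U0 linear0 mxE.
have -> : dot (u *m K) u = frob U (ehess f P U); last exact: nondeg.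
have fU V : frob U V = \sum_k u 0 k * frob (ebasis Q k) V.
  rewrite frobC linear_sum; apply: eq_bigr => k _.
  by rewrite linearZ /= frobC.
have eU : ehess f P U = \sum_l u 0 l *: ehess f P (ebasis Q l).
  rewrite /ehess linear_sum; apply: eq_bigr => l _; exact: linearZ.
rewrite fU eU dotE.
under eq_bigr do rewrite mxE mulr_suml.
rewrite exchange_big /=; apply: eq_bigr => k _.
rewrite linear_sum mulr_sumr; apply: eq_bigr => l _.
by rewrite linearZ /= mxE -mulrA; congr (_ * _); exact: mulrC.
Qed.

(** Since g_P(Hess f[Y], Z) is the Euclidean second derivative at a critical
    point, a metric that is diagonal in the basis divides the rows of the
    Euclidean Hessian by its diagonal coefficients. *)
Lemma rhess_mx (g : metric R n) (gamma : basis_idx n -> R) : riemannian g ->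
  (forall k, 0 < gamma k) ->
  (forall k Z, g P (sym_basis Q k) Z = gamma k * frob (sym_basis Q k) Z) ->
  mx_in_basis Q (rhess g f P) =
    diag_mx (\row_k (gamma (enum_val k))^-1) *m K.
Proof.
move=> gR gamma0 gQ; apply/matrixP => k l.
rewrite mul_diag_mx !mxE; apply: (mulfI (lt0r_neq0 (gamma0 (enum_val k)))).
rewrite mulrA divff ?gt_eqF // mul1r -gQ metric_sym //.
rewrite rhess_critical //; last exact: minimizer_critical.
by rewrite -ehess_form // frobC.
Qed.

End HessiansAtMinimum.

Theorem mainTheorem3 (R : realType) (n : nat) (f : Sym R n -> R)
    (Pstar : Sym R n) (Q : 'M[R]_n) (d : 'rV[R]_n)
    (f_C2 : contdiff 2 (@spd R n) f)
    (Pstar_min : local_minimizer f Pstar)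
    (Pstar_nondeg : nondegenerate_at f Pstar)
    (Q_orth : Q^T *m Q = 1%:M)
    (Pstar_eig : symval Pstar = Q *m diag_mx d *m Q^T)
    (kappa_gt : Num.sqrt 2 * kappa (mx_in_basis Q (ehess f Pstar))
                < kappa (symval Pstar)) :
  kappa (mx_in_basis Q (rhess (procrustes_metric 1) f Pstar))
  < kappa (mx_in_basis Q (rhess (@ai_metric R n) f Pstar)).
Proof.
have [spdP _] := Pstar_min; have d0 := spd_eig_gt0 spdP Q_orth Pstar_eig.
(* For n = 0 both condition numbers in the hypothesis are 0 / 0 = 0. *)
have n0 : (0 < n)%N.
  rewrite lt0n; apply: contraTN kappa_gt => /eqP n0; rewrite -leNgt.
  rewrite !kappa_mx0 ?mulr0 //; apply/eqP; rewrite -leqn0 leqNgt.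
  by apply/negP => /card_gt0P [[[[i +] _] _] _]; rewrite n0.
pose o : basis_idx n := exist _ (Ordinal n0, Ordinal n0) (leqnn _).
have N0 : (0 < #|basis_idx n|)%N by apply/card_gt0P; exists o.
set K := mx_in_basis Q (ehess f Pstar) in kappa_gt *.
have symK : K^T = K by exact: ehess_mx_sym.
have posK u : u != 0 -> 0 < dot (u *m K) u by exact: ehess_mx_pos.
have kE0 : 0 < kappa K := kappa_gt0 N0 symK posK.
pose dl (k : basis_idx n) := d 0 (val k).1; pose dr (k : basis_idx n) := d 0 (val k).2.
have dl0 k : 0 < dl k by exact: d0.
have dr0 k : 0 < dr k by exact: d0.
have k1_le : kappa (mx_in_basis Q (rhess (procrustes_metric 1) f Pstar)) <=
    2 * kappa K.
  pose gamma k := (dl k + dr k) ^+ 2 / (2 * (dl k ^+ 2 + dr k ^+ 2)).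
  have gamma0 k : 0 < gamma k.
    by rewrite /gamma divr_gt0 ?exprn_gt0 ?mulr_gt0 ?addr_gt0 ?exprn_gt0.
  have gammaE k Z : procrustes_metric 1 Pstar (sym_basis Q k) Z =
      gamma k * frob (sym_basis Q k) Z by exact: procrustes_diag.
  rewrite (rhess_mx f_C2 Pstar_min (procrustes_riemannian R n) gamma0 gammaE).
  (* The weights 1 / gamma lie in [1, 2], since
     (a + b)^2 <= 2 (a^2 + b^2) <= 2 (a + b)^2 for a, b > 0. *)
  rewrite -[2]divr1; apply: (kappa_scaled_le N0 symK posK) => // k.
  rewrite mxE invf_div; move: (dl _) (dr _) (dl0 (enum_val k)) (dr0 (enum_val k)).
  move=> a b a0 b0; have ab0 : 0 < (a + b) ^+ 2 by rewrite exprn_gt0 // addr_gt0.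
  rewrite ler_pdivlMr // ler_pdivrMr // mul1r.
  have := sqr_ge0 (a - b); have := mulr_gt0 a0 b0.
  by rewrite sqrrB sqrrD; move=> h1 h2; apply/andP; split; lra.
have [a [b [aP bP kP]]] := kappa_quotient n0 (sym_tr Pstar).
rewrite Pstar_eig in aP bP.
have [i aE] := eigenvalue_diag Q_orth aP; have [j bE] := eigenvalue_diag Q_orth bP.
have kAI_ge : kappa (symval Pstar) ^+ 2 <=
    kappa (mx_in_basis Q (rhess (@ai_metric R n) f Pstar)) * kappa K.
  pose gamma k := (dl k * dr k)^-1.
  have gamma0 k : 0 < gamma k by rewrite /gamma invr_gt0 mulr_gt0.
  have gammaE k Z : ai_metric Pstar (sym_basis Q k) Z =
      gamma k * frob (sym_basis Q k) Z by exact: ai_diag.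
  rewrite (rhess_mx f_C2 Pstar_min (ai_riemannian R n) gamma0 gammaE).
  (* The weights of the diagonal basis matrices are the squares d_i^2, whose
     largest ratio is the square of kappa(P). *)
  pose ii (i : 'I_n) : basis_idx n := exist _ (i, i) (leqnn i).
  set w := \row_k _.
  have wii l : w 0 (enum_rank (ii l)) = d 0 l * d 0 l.
    by rewrite mxE enum_rankK invrK.
  have -> : kappa (symval Pstar) ^+ 2 =
      w 0 (enum_rank (ii i)) / w 0 (enum_rank (ii j)).
    by rewrite kP aE bE !wii expr_div_n !expr2.
  apply: (kappa_scaled_ge N0 symK posK) => k.
  by rewrite mxE invrK mulr_gt0.
(* 2 kappa(K)^2 < kappa(P)^2 <= kappa(H_AI) kappa(K). *)
apply: (le_lt_trans k1_le); rewrite -(ltr_pM2r kE0); apply: lt_le_trans kAI_ge.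
have -> : 2 * kappa K * kappa K = (Num.sqrt 2 * kappa K) ^+ 2.
  by rewrite exprMn sqr_sqrtr // expr2 mulrA.
rewrite ltr_pXn2r // nnegrE; first by rewrite mulr_ge0 ?sqrtr_ge0 ?ltW.
by apply: ltW; apply: le_lt_trans kappa_gt; rewrite mulr_ge0 ?sqrtr_ge0 ?ltW.
Qed.
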